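(* Let $X\to Y$ be a flat finite type morphism of Noetherian affine schemes, $B=\Gamma(Y,\mathcal O_Y)$, $A=\Gamma(X,\mathcal O_X)$, let $t\in B$ and $w\in A$ be non-zero-divisors such that $t$ is a non-zero-divisor in $A/(w^r)$ for all $r$, set $Z_r:=\operatorname{Spec}A/(w^r)$, and assume that $\mathcal T^1_{X/Y}$ is supported in $\{tw=0\}$. Then there exist $N>0$ and $M>0$ with the following property. Whenever $X'\to Y$ is another flat morphism of Noetherian affine schemes, $w'\in\Gamma(X',\mathcal O_{X'})$, $Z'_r\subset X'$ is the closed subscheme $\{(w')^r=0\}$, and $\varphi:X'_k\cup Z'_r\to X_k\cup Z_r$ is an isomorphism over $Y$ for some $k>4N$ and $r>4M$ with $\varphi^*(w)=w'$ (so that it restricts to an isomorphism $Z'_r\xrightarrow{\sim}Z_r$), there is an isomorphism $\widehat\varphi:\widehat X'\to\widehat X$ commuting with the maps to $\widehat Y$ such that the restrictions of $\widehat\varphi$ and $\varphi$ to $X'_{k-2N}\cup\widehat Z'_{r-2M}$ agree, where $\widehat Z'_{r-2M}$ is the completion of $Z'_{r-2M}$ in $t$.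
   Context: For a ring map $B\to A$ with a presentation $A=P/J$, $P=B[z_1,\dots,z_n]$, and an $A$-module $M$, one defines $T^1(A/B,M)=\operatorname{coker}\big(\operatorname{Der}_B(P,M)\to\operatorname{Hom}_A(J,M)\big)$ (independent of the presentation); $\mathcal T^1_{X/Y}$ denotes the coherent sheaf associated to $T^1(A/B,A)$. For $k\ge1$, $X_k$ denotes the base change of $X\to Y$ to $\operatorname{Spec}B/(t^k)$, similarly $X'_k$; $\widehat X\to\widehat Y$ and $\widehat X'$ denote completions in $t$. A union of closed subschemes is defined by the intersection of their ideals. *)

(* Defs.v *)
(* Affine schemes are encoded by their rings of global
   sections. *)
From HB Require Import structures.
From mathcomp Require Import all_boot all_order all_algebra.
From mathcomp Require Import mpoly.
Set Implicit Arguments. Unset Strict Implicit. Unset Printing Implicit Defensive.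
Import Order.TTheory GRing.Theory.
Local Open Scope ring_scope.

Definition in_pid (R : comPzRingType) (x a : R) : Prop := exists c : R, a = c * x.

Definition nzd (R : comPzRingType) (x : R) : Prop :=
  forall y : R, x * y = 0 -> y = 0.

Definition is_ideal (R : comPzRingType) (I : R -> Prop) : Prop :=
  [/\ I 0, (forall x y, I x -> I y -> I (x + y)) & (forall r x, I x -> I (r * x))].

Definition prime_ideal (R : comPzRingType) (I : R -> Prop) : Prop :=
  [/\ is_ideal I, ~ I 1 & (forall x y, I (x * y) -> I x \/ I y)].

Definition in_ideal_gen (R : comPzRingType) (s : seq R) (x : R) : Prop :=
  exists c : 'I_(size s) -> R, x = \sum_(i < size s) c i * s`_i.

Definition noetherian (R : comPzRingType) : Prop :=
  forall I : R -> Prop, is_ideal I ->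
    exists s : seq R, forall x, I x <-> in_ideal_gen s x.

(* Flatness: -- (x)_B A preserves injectivity of B-linear maps.         *)
(* The tensor product M (x)_B A is the free abelian group on M * A       *)
(* modulo the bilinearity relations; an element is represented by a      *)
(* formal Z-combination (a sequence of (coefficient, (m, a)) pairs).     *)

Section Tensor.
Variables (B : comNzRingType) (A : comPzRingType) (f : {rmorphism B -> A}).
Variable (M : lmodType B).

Definition fcoef (s : seq (int * (M * A))) (p : M * A) : int :=
  \sum_(x <- s | x.2 == p) x.1.

Inductive tgen :=
  | TAddL of M & M & A
  | TAddR of M & A & A
  | TScal of B & M & A.

Definition tgen_sum (g : tgen) : seq (int * (M * A)) :=
  match g with
  | TAddL m1 m2 a => [:: (1%:Z, (m1 + m2, a)); (-1, (m1, a)); (-1, (m2, a))]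
  | TAddR m a1 a2 => [:: (1%:Z, (m, a1 + a2)); (-1, (m, a1)); (-1, (m, a2))]
  | TScal b m a => [:: (1%:Z, (b *: m, a)); (-1, (m, f b * a))]
  end.

Definition tensor_zero (s : seq (int * (M * A))) : Prop :=
  exists rs : seq (int * tgen),
    forall p, fcoef s p = \sum_(x <- rs) x.1 * fcoef (tgen_sum x.2) p.

End Tensor.

Definition flat (B : comNzRingType) (A : comPzRingType) (f : {rmorphism B -> A}) : Prop :=
  forall (M N : lmodType B) (g : {linear M -> N}), injective g ->
    forall s : seq (int * (M * A)),
      tensor_zero f (map (fun x => (x.1, (g x.2.1, x.2.2))) s) ->
      tensor_zero f s.

Definition peval (B : comNzRingType) (A : comPzRingType) (f : {rmorphism B -> A})
  (n : nat) (v : 'I_n -> A) (p : {mpoly B[n]}) : A :=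
  \sum_(m <- msupp p) f p@_m * \prod_(i < n) v i ^+ m i.

Definition presentation (B : comNzRingType) (A : comPzRingType)
  (f : {rmorphism B -> A}) (n : nat) (v : 'I_n -> A) : Prop :=
  forall a : A, exists p : {mpoly B[n]}, peval f v p = a.

Definition finite_type (B : comNzRingType) (A : comPzRingType)
  (f : {rmorphism B -> A}) : Prop :=
  exists n (v : 'I_n -> A), presentation f v.

Section T1.
Variables (B : comNzRingType) (A : comPzRingType) (f : {rmorphism B -> A}).
Variables (n : nat) (v : 'I_n -> A).
Local Notation P := {mpoly B[n]}.
Local Notation pi := (peval f v).
Local Notation inJ j := (pi j = 0).

Definition is_der (D : P -> A) : Prop :=
  [/\ forall p q, D (p + q) = D p + D q,
      forall p q, D (p * q) = pi p * D q + pi q * D p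
    & forall (b : B) p, D (b%:MP * p) = f b * D p].

(* phi in Hom_A(J, A) (phi : P -> A, only its values on J matter) *)
Definition is_homJ (phi : P -> A) : Prop :=
  (forall j1 j2, inJ j1 -> inJ j2 -> phi (j1 + j2) = phi j1 + phi j2) /\
  (forall p j, inJ j -> phi (p * j) = pi p * phi j).

(* T^1(A/B, A) = coker(Der_B(P,A) -> Hom_A(J,A)) has support in V(g):
   for every prime q not containing g, the localisation T^1_q is 0,
   i.e. each class [phi] is killed by some s outside q. *)
Definition T1_support_in (g : A) : Prop :=
  forall q : A -> Prop, prime_ideal q -> ~ q g ->
  forall phi : P -> A, is_homJ phi ->
  exists s : A, ~ q s /\
    exists D : P -> A, is_der D /\ forall j, inJ j -> s * phi j = D j.

End T1.

(* T^1_{X/Y} (computed from some presentation; it is independent of it)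
   is supported in {g = 0} *)
Definition T1_supported_in (B : comNzRingType) (A : comPzRingType)
  (f : {rmorphism B -> A}) (g : A) : Prop :=
  exists n (v : 'I_n -> A), presentation f v /\ T1_support_in f v g.

Definition in_union_ideal (R : comPzRingType) (t w : R) (k r : nat) (a : R) : Prop :=
  in_pid (t ^+ k) a /\ in_pid (w ^+ r) a.

(* phi : A -> A' represents (on representatives) the ring map
   phi^* : A/((t^k) \cap (w^r)) -> A'/((t^k) \cap (w'^r)), required to be
   a well defined ring isomorphism over B with phi^*(w) = w'. *)
Definition quot_iso (B : comNzRingType) (A A' : comPzRingType)
  (f : {rmorphism B -> A}) (f' : {rmorphism B -> A'}) (t : B) (w : A) (w' : A')
  (k r : nat) (phi : A -> A') : Prop :=
  let I := in_union_ideal (f t) w k r in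
  let I' := in_union_ideal (f' t) w' k r in
  (forall a b, I (a - b) -> I' (phi a - phi b)) /\
  (forall a b, I' (phi (a + b) - (phi a + phi b))) /\
  (forall a b, I' (phi (a * b) - phi a * phi b)) /\
  I' (phi 1 - 1) /\
  (forall b : B, I' (phi (f b) - f' b)) /\
  (forall a, I' (phi a) -> I a) /\
  (forall a' : A', exists a, I' (phi a - a')) /\
  I' (phi w - w').

(* t-adic completion: R^ = lim R/t^n R, elements represented by
   compatible sequences a with a (n+1) = a n mod t^n. *)
Definition compat (R : comPzRingType) (t : R) (a : nat -> R) : Prop :=
  forall n, in_pid (t ^+ n) (a n.+1 - a n).

Definition ceq (R : comPzRingType) (t : R) (a b : nat -> R) : Prop :=
  forall n, in_pid (t ^+ n) (a n - b n).

(* Phi represents a ring isomorphism A^ -> A'^ of t-adic completions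
   compatible with the structure maps B^ -> A^, B^ -> A'^, i.e. the
   pull-back of an isomorphism X'^ -> X^ over Y^. *)
Definition compl_iso (B : comNzRingType) (A A' : comPzRingType)
  (f : {rmorphism B -> A}) (f' : {rmorphism B -> A'}) (t : B)
  (Phi : (nat -> A) -> (nat -> A')) : Prop :=
  let tA := f t in let tA' := f' t in
  (forall a, compat tA a -> compat tA' (Phi a)) /\
  (forall a c, compat tA a -> compat tA c -> ceq tA a c -> ceq tA' (Phi a) (Phi c)) /\
  (forall a c, compat tA a -> compat tA c ->
     ceq tA' (Phi (fun n => a n + c n)) (fun n => Phi a n + Phi c n)) /\
  (forall a c, compat tA a -> compat tA c ->
     ceq tA' (Phi (fun n => a n * c n)) (fun n => Phi a n * Phi c n)) /\
  ceq tA' (Phi (fun _ => 1)) (fun _ => 1) /\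
  (forall b : nat -> B, compat t b ->
     ceq tA' (Phi (fun n => f (b n))) (fun n => f' (b n))) /\
  (forall a c, compat tA a -> compat tA c -> ceq tA' (Phi a) (Phi c) -> ceq tA a c) /\
  (forall x, compat tA' x -> exists a, compat tA a /\ ceq tA' (Phi a) x).

(* The restrictions of Phi (i.e. of hat-phi) and of phi to
   X'_{k'} \cup hat Z'_{r'} agree.  The ring of this formal subscheme is
   lim_n A'/(t^n A' + ((t^k') \cap (w'^r'))); the restriction of phi to it
   is induced by phi on representatives. *)
Definition restr_agree (B : comNzRingType) (A A' : comPzRingType)
  (f : {rmorphism B -> A}) (f' : {rmorphism B -> A'}) (t : B) (w' : A')
  (k' r' : nat) (phi : A -> A') (Phi : (nat -> A) -> (nat -> A')) : Prop :=
  forall a, compat (f t) a -> forall n : nat,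
    exists u v : A', Phi a n - phi (a n) = u + v /\
      in_pid (f' t ^+ n) u /\ in_union_ideal (f' t) w' k' r' v.

(* Main.v *)
Require Import Defs.
From HB Require Import structures.
From mathcomp Require Import all_boot all_order all_algebra.
From mathcomp Require Import mpoly.
From mathcomp Require Import ring zify.
From Stdlib Require Import Classical ClassicalEpsilon.
Import GRing.Theory.
Local Open Scope ring_scope.

(** By flatness [t] is a non-zero-divisor on [A'].
  Write [A = P/J] with [P = B[z_1..z_n]] and [J] generated by [F_i],
    and lift the given isomorphism to [psi : P -> A'] with
    [psi J] contained in [(t^K w'^r)].  The map [F_i |-> psi F_i / (t^K w'^r)]
    is an element of [Hom(J, A/(t^K w^r))]; by Noetherianity the obstruction to
    lifting it to [Hom(J, A)] and the class of the lift in [T^1] are both killed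
    by [(tw)^N] with [N] independent of [K] and [r].  So [(tw)^N] times it
    is induced by a derivation [D : P -> A], and replacing [psi] by
    [psi - t^(K-N) w'^(r-N) D] improves [K] to [K+1].  The limit of these maps is
    the required isomorphism. *)

(** Nothing makes [w'] a non-zero-divisor on [A'], so the quotients psi F_i / (t^K w'^r) need not
    respect the syzygies of the F_i on the nose. But [w'] is regular modulo every power of t, as the
    given isomorphism shows modulo t. Hence the failure, which is killed by w'^r, lies in every
    (t^n), and by Krull some 1 - t e kills it. Multiplying the quotients by this factor, which is 1
    modulo t, restores the syzygies without spoiling the cancellation to order K+1.

    Only t-adic limits are available, so K grows while r stays fixed. The correction has size E =
    t^(K-N) w'^(r-N). Its square must lie in (t^(K+1) w'^r) for the second-order terms to vanish,
    which is where 2N < K and 2N <= r come from.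

    The derivation D takes values in A and reaches A' only through psi, which is well defined modulo
    (t^K w'^r). So psi must be shown injective and surjective modulo this ideal for every K, while
    the given isomorphism speaks only of exponent k. *)

Lemma fun_choice (T U : Type) (P : T -> U -> Prop) :
  (forall x, exists y, P x y) -> exists h : T -> U, forall x, P x (h x).
Proof.
move=> H; exists (fun x => proj1_sig (constructive_indefinite_description _ (H x))).
by move=> x; case: constructive_indefinite_description.
Qed.

Lemma uniform_bound (n : nat) (P : 'I_n -> nat -> Prop) :
  (forall i a b, (a <= b)%N -> P i a -> P i b) -> (forall i, exists a, P i a) ->
  exists a, forall i, P i a.
Proof.
move=> mono /fun_choice[a Ha]; exists (\sum_i a i)%N => i.
by apply: mono (Ha i); rewrite (bigD1 i) //= leq_addr.
Qed.

(** * Noetherian rings *)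

Section Ideals.
Variable R : comPzRingType.
Implicit Types (I J : R -> Prop) (x y : R) (s : seq R).

Lemma ideal_sum I (K : finType) (F : K -> R) :
  is_ideal I -> (forall i, I (F i)) -> I (\sum_i F i).
Proof. by case=> I0 ID _ IF; apply: (big_ind I). Qed.

Lemma ideal_opp I x : is_ideal I -> I x -> I (- x).
Proof. by case=> _ _ IM Ix; rewrite -mulN1r; apply: IM. Qed.

Lemma ideal_sub I x y : is_ideal I -> I x -> I y -> I (x - y).
Proof. by move=> idI Ix Iy; have [_ ID _] := idI; apply: ID => //; apply: ideal_opp. Qed.

Lemma ideal_pid x : is_ideal (in_pid x).
Proof.
split; first by exists 0; rewrite mul0r.
- by move=> _ _ [c ->] [d ->]; exists (c + d); rewrite mulrDl.
- by move=> r _ [c ->]; exists (r * c); rewrite mulrA.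
Qed.

Lemma ideal_gen s : is_ideal (in_ideal_gen s).
Proof.
split; first by exists (fun=> 0); rewrite big1 // => i _; rewrite mul0r.
- move=> _ _ [c ->] [d ->]; exists (fun i => c i + d i).
  by rewrite -big_split; apply: eq_bigr => i _ /=; rewrite mulrDl.
- move=> r _ [c ->]; exists (fun i => r * c i).
  by rewrite mulr_sumr; apply: eq_bigr => i _; rewrite mulrA.
Qed.

Lemma mem_gen s x : x \in s -> in_ideal_gen s x.
Proof.
move=> xs; exists (fun i : 'I_(size s) => (i == index x s :> nat)%:R).
have lt_i : (index x s < size s)%N by rewrite index_mem.
rewrite (bigD1 (Ordinal lt_i)) //= eqxx mul1r nth_index // big1 ?addr0 // => i.
by rewrite -val_eqE /= => /negPf->; rewrite mul0r.
Qed.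

Lemma gen_min I s x :
  is_ideal I -> (forall y, y \in s -> I y) -> in_ideal_gen s x -> I x.
Proof.
move=> idI sI [c ->]; apply: ideal_sum => // i.
by have [_ _ IM] := idI; apply: IM; apply: sI; apply: mem_nth.
Qed.

Lemma noetherian_acc (I : nat -> R -> Prop) : noetherian R ->
  (forall n, is_ideal (I n)) -> (forall n x, I n x -> I n.+1 x) ->
  exists n, forall m x, I m x -> I n x.
Proof.
move=> noeR idI incI.
have mono m n x : (m <= n)%N -> I m x -> I n x.
  by move=> /subnK <-; elim: (n - m)%N => // d IHd /IHd /incI.
have idU : is_ideal (fun x => exists n, I n x).
  split; first by exists 0%N; have [] := idI 0%N.
  - move=> x y [m Ix] [n Iy]; exists (maxn m n); have [_ ID _] := idI (maxn m n).
    by apply: ID; [apply: mono Ix; apply: leq_maxl | apply: mono Iy; apply: leq_maxr].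
  - by move=> r x [n Ix]; exists n; have [_ _ IM] := idI n; apply: IM.
have [s Hs] := noeR _ idU.
have [n Hn] : exists n, forall i : 'I_(size s), I n s`_i.
  apply: (uniform_bound _ (fun (i : 'I_(size s)) n => I n s`_i)).
  - by move=> i a b le_ab; apply: mono.
  - by move=> i; apply/Hs; apply: mem_gen; apply: mem_nth.
exists n => m x Ix; apply: (gen_min _ s) => //.
- by move=> y /(nthP 0)[i lt_i <-]; apply: (Hn (Ordinal lt_i)).
- by apply/Hs; exists m.
Qed.

(** An ideal maximal among those containing [I] and missing all powers of [g] is prime. The maximal
    one comes from the ascending chain condition: otherwise a choice of strictly larger ideals could
    be iterated forever. *)
Lemma prime_avoiding I (g : R) : noetherian R -> is_ideal I ->
  (forall n, ~ I (g ^+ n)) ->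
  exists q, [/\ prime_ideal q, forall x, I x -> q x & ~ q g].
Proof.
move=> noeR idI Ig.
pose C (Q : R -> Prop) :=
  [/\ is_ideal Q, forall x, I x -> Q x & forall n, ~ Q (g ^+ n)].
have [Q [CQ maxQ]] :
    exists Q, C Q /\ forall Q', C Q' -> (forall x, Q x -> Q' x) -> forall x, Q' x -> Q x.
  apply: NNPP => noMax.
  have step (Q : {Q | C Q}) : exists Q' : {Q | C Q},
      (forall x, sval Q x -> sval Q' x) /\ ~ (forall x, sval Q' x -> sval Q x).
    case: Q => Q CQ; apply: NNPP => H; apply: noMax; exists Q; split=> // Q' CQ' QQ'.
    by apply: NNPP => H'; apply: H; exists (exist _ Q' CQ').
  have [next Hnext] := fun_choice _ _ _ step.
  have CI : C I by [].
  pose chain n := iter n next (exist _ I CI).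
  have [n Hn] : exists n, forall m x, sval (chain m) x -> sval (chain n) x.
    apply: noetherian_acc => // [n | n x].
    - by case: (svalP (chain n)).
    - by have [H _] := Hnext (chain n); apply: H.
  by have [_] := Hnext (chain n); apply; apply: (Hn n.+1).
have [idQ IQ Qg] := CQ; have [Q0 QD QM] := idQ.
exists Q; split=> //; last by move: (Qg 1%N); rewrite expr1.
split=> //; first by move: (Qg 0%N); rewrite expr0.
(* This is the ideal Q + (x). If neither x nor y is in Q, maximality puts a power of [g] in both Q +
   (x) and Q + (y), and the product of the two powers falls in Q + (xy) = Q. *)
pose ext x y := exists a b, Q a /\ y = a + b * x.
have ext_id x : is_ideal (ext x).
  split; first by exists 0, 0; split=> //; ring.
  - move=> _ _ [a [b [Qa ->]]] [c [d [Qc ->]]].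
    by exists (a + c), (b + d); split; [apply: QD | ring].
  - move=> r _ [a [b [Qa ->]]].
    by exists (r * a), (r * b); split; [apply: QM | ring].
have extQ x y : Q y -> ext x y by move=> Qy; exists y, 0; split=> //; ring.
have ext_pow x : ~ Q x -> exists n, ext x (g ^+ n).
  move=> nQx; apply: NNPP => H; apply: nQx; apply: (maxQ (ext x)).
  - by split=> // [y /IQ /extQ | n Hn] //; apply: H; exists n.
  - by move=> y; apply: extQ.
  - by exists 0, 1; split=> //; ring.
move=> x y Qxy; apply: NNPP => H.
have [m [a [b [Qa gm]]]] : exists n, ext x (g ^+ n).
  by apply: ext_pow => Qx; apply: H; left.
have [n [c [d [Qc gn]]]] : exists n, ext y (g ^+ n).
  by apply: ext_pow => Qy; apply: H; right.
apply: (Qg (m + n)%N); rewrite exprD gm gn.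
have -> : (a + b * x) * (c + d * y) = (c + d * y) * a + b * x * c + b * d * (x * y).
  by ring.
by apply: (QD); [apply: (QD)|]; apply: (QM).
Qed.

(** Turns a support condition, stated prime by prime, into a single power of [g]; [I] will be the
    annihilator of a class in T^1. *)
Lemma radical_of_primes I (g : R) : noetherian R -> is_ideal I ->
  (forall q, prime_ideal q -> ~ q g -> exists u, ~ q u /\ I u) ->
  exists n, I (g ^+ n).
Proof.
move=> noeR idI H; apply: NNPP => Ig.
have [q [pq Iq qg]] : exists q, [/\ prime_ideal q, forall x, I x -> q x & ~ q g].
  by apply: prime_avoiding => // n In; apply: Ig; exists n.
by have [s [nqs Is]] := H q pq qg; apply/nqs/Iq.
Qed.

Lemma row_mx_head (m : nat) (x : 'rV[R]_(1 + m)) : x = row_mx (x 0 0)%:M (rsubmx x).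
Proof.
rewrite -[LHS]hsubmxK; congr row_mx; apply/matrixP => i j; rewrite !ord1 !mxE /=.
by congr (x _ _); apply/val_inj.
Qed.

(** Induction on [m]: lifts of generators of the ideal of first coordinates, together with
    generators of the vectors of [S] with first coordinate 0. *)
Lemma noetherian_submodule (m : nat) (S : 'rV[R]_m -> Prop) : noetherian R ->
  S 0 -> (forall u v, S u -> S v -> S (u + v)) -> (forall a u, S u -> S (a *: u)) ->
  exists q (M : 'M[R]_(q, m)), (forall i, S (row i M)) /\
    forall u, S u -> exists c : 'rV_q, u = c *m M.
Proof.
move=> noeR; elim: m S => [|m IHm] S S0 SD SZ.
  by exists 0%N, 0; split=> [[] // | x _]; exists 0; apply/rowP => -[].
have SMc q (M : 'M[R]_(q, m.+1)) (c : 'rV_q) : (forall i, S (row i M)) -> S (c *m M).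
  move=> SM; rewrite mulmx_sum_row; apply: (big_ind S) => // i _; exact: SZ.
pose I a := exists y : 'rV_m, S (row_mx a%:M y).
have idI : is_ideal I.
  split; first by exists 0; rewrite raddf0 row_mx0.
  - move=> a b [y Sy] [z Sz]; exists (y + z).
    by rewrite raddfD /= -add_row_mx; apply: SD.
  - move=> r a [y Sy]; exists (r *: y).
    by rewrite -scale_scalar_mx -scale_row_mx; apply: SZ.
have [s Hs] := noeR I idI.
have [Y HY] : exists Y : 'I_(size s) -> 'rV_m, forall i : 'I_(size s), S (row_mx (s`_i)%:M (Y i)).
  have HI (i : 'I_(size s)) : I s`_i by apply/Hs; apply: mem_gen; apply: mem_nth.
  exact: fun_choice HI.
pose S' (y : 'rV[R]_m) := S (row_mx (0 : 'rV_1) y).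
have [| | |q [M' [SM' HM']]] := IHm S'.
- by rewrite /S' row_mx0.
- by move=> x y Sx Sy; rewrite /S' -[0]addr0 -add_row_mx; apply: SD.
- by move=> a x Sx; rewrite /S' -[0](scaler0 _ a) -scale_row_mx; apply: SZ.
pose M1 : 'M[R]_(size s, 1 + m) := \matrix_i row_mx (s`_i)%:M (Y i).
have SM1 i : S (row i M1) by rewrite rowK.
pose N : 'M[R]_(q, 1 + m) := row_mx 0 M'.
have SN i : S (row i N) by rewrite row_row_mx row0; apply: SM'.
exists (size s + q)%N, (col_mx M1 N); split.
  by move=> i; case: (split_ordP i) => j ->; rewrite ?rowKu ?rowKd.
move=> x Sx; pose a := x 0 0.
have /Hs[c ac] : I a by exists (rsubmx (x : 'rV_(1 + m))); rewrite -row_mx_head.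
pose c1 : 'rV_(size s) := \row_i c i.
have head0 : (x - c1 *m M1 : 'rV_(1 + m)) 0 0 = 0.
  rewrite mxE [(- _ : 'M_(_, _)) _ _]mxE [(_ *m _) _ _]mxE -/a ac -sumrB big1 // => k _.
  suff -> : M1 k 0 = s`_k by rewrite mxE subrr.
  rewrite mxE; transitivity (row_mx (s`_k)%:M (Y k) 0 (lshift m 0)).
    by congr (row_mx _ _ _ _); apply/val_inj.
  by rewrite row_mxEl mxE.
have Sz : S (x - c1 *m M1).
  by rewrite -scaleN1r; apply: SD => //; apply: SZ; apply: SMc.
rewrite [x - _]row_mx_head head0 raddf0 in Sz.
have [c2 Hc2] := HM' _ Sz.
exists (row_mx c1 c2); rewrite mul_row_col; apply/eqP; rewrite addrC -subr_eq; apply/eqP.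
rewrite [LHS]row_mx_head head0 raddf0 Hc2 /N.
by rewrite (@mul_mx_row _ 1 q 1 m) mulmx0.
Qed.

End Ideals.

(** * Hilbert's basis theorem *)

Lemma gen_sub (R : comPzRingType) (s s' : seq R) (x : R) :
  {subset s <= s'} -> in_ideal_gen s x -> in_ideal_gen s' x.
Proof.
move=> ss'; apply: gen_min; first exact: ideal_gen.
by move=> y /ss' ys'; apply: mem_gen.
Qed.

(** The ideals [L n] of degree-n coefficients of members of [I] of degree at most n increase and
    stabilise at some [N]. Generators for all n <= N suffice: in higher degree a member for [L N] is
    shifted by a power of ['X] to cancel the top coefficient. *)
Lemma noetherian_poly (R : comNzRingType) : noetherian R -> noetherian {poly R}.
Proof.
move=> noeR I idI; have [I0 ID IM] := idI.
pose L n a := exists2 p, I p & (size p <= n.+1)%N /\ p`_n = a.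
have idL n : is_ideal (L n).
  split; first by exists 0 => //; rewrite size_poly0 coef0.
  - move=> _ _ [p Ip [sp <-]] [q Iq [sq <-]]; exists (p + q); first exact: ID.
    by rewrite coefD (leq_trans (size_polyD _ _)) // geq_max sp.
  - move=> r _ [p Ip [sp <-]]; exists (r%:P * p); first exact: IM.
    by rewrite mul_polyC coefZ (leq_trans (size_scale_leq _ _)).
have incL n a : L n a -> L n.+1 a.
  move=> [p Ip [sp <-]]; exists ('X * p); first exact: IM.
  by rewrite coefXM (leq_trans (size_polyMleq _ _)) // size_polyX.
have [N HN] := noetherian_acc _ _ noeR idL incL.
have fgL n : exists s, (forall q, q \in s -> I q) /\
    forall a, L n a -> exists2 p, in_ideal_gen s p & (size p <= n.+1)%N /\ p`_n = a.
  have [s Hs] := noeR _ (idL n).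
  have HL (i : 'I_(size s)) : L n s`_i by apply/Hs; apply: mem_gen; apply: mem_nth.
  have [p Hp] : exists p : 'I_(size s) -> {poly R},
      forall i, [/\ I (p i), (size (p i) <= n.+1)%N & (p i)`_n = s`_i].
    apply: (fun_choice _ _ (fun (i : 'I_(size s)) q => [/\ I q, (size q <= n.+1)%N & q`_n = s`_i])) => i.
    by have [q Iq [sq qn]] := HL i; exists q.
  exists [seq p i | i <- enum 'I_(size s)]; split.
    by move=> q /mapP[i _ ->]; case: (Hp i).
  move=> a /Hs[c ->]; exists (\sum_i (c i)%:P * p i).
    apply: ideal_sum; first exact: ideal_gen.
    move=> i; have [_ _ GM] := ideal_gen _ [seq p i | i <- enum 'I_(size s)].
    by apply: GM; apply: mem_gen; apply: map_f; rewrite mem_enum.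
  split; last first.
    by rewrite coef_sum; apply: eq_bigr => i _; rewrite coefCM; case: (Hp i) => _ _ ->.
  apply: (leq_trans (size_sum _ _ _)); apply/bigmax_leqP => i _.
  by rewrite mul_polyC (leq_trans (size_scale_leq _ _)) //; case: (Hp i).
have [s [sI Hs]] : exists s, (forall q, q \in s -> I q) /\ forall n, (n <= N)%N ->
    forall a, L n a -> exists2 p, in_ideal_gen s p & (size p <= n.+1)%N /\ p`_n = a.
  move: N {HN} => N; elim: N => [|N [s [sI Hs]]].
    have [s [sI Hs]] := fgL 0%N; exists s; split=> // n.
    by rewrite leqn0 => /eqP ->.
  have [s' [sI' Hs']] := fgL N.+1; exists (s ++ s'); split.
    by move=> q; rewrite mem_cat => /orP[/sI | /sI'].
  move=> n; rewrite leq_eqVlt => /orP[/eqP-> | ltn] a La.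
    have [p gp Hp] := Hs' a La; exists p => //.
    by apply: gen_sub gp => q qs; rewrite mem_cat qs orbT.
  have [p gp Hp] := Hs n ltn a La; exists p => //.
  by apply: gen_sub gp => q qs; rewrite mem_cat qs.
exists s => p; split; last exact: gen_min.
have [_ GD GM] := ideal_gen _ s.
move: {2}(size p) (leqnn (size p)) => n; elim: n p => [|n IHn] p sp Ip.
  by move: sp; rewrite leqn0 size_poly_eq0 => /eqP->; case: (ideal_gen _ s).
have [q gq [sq qn]] : exists2 q, in_ideal_gen s q & (size q <= n.+1)%N /\ q`_n = p`_n.
  have Lp : L n p`_n by exists p.
  have [le_nN | lt_Nn] := leqP n N; first exact: Hs.
  have [q gq [sq qN]] := Hs N (leqnn N) _ (HN _ _ Lp).
  exists ('X^(n - N) * q); first exact: GM.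
  rewrite coefXnM ltnNge leq_subr /= subKn ?(ltnW lt_Nn) //; split=> //.
  rewrite (leq_trans (size_polyMleq _ _)) // size_polyXn addSn /=.
  by rewrite (leq_trans (leq_add (leqnn _) sq)) // addnS subnK // ltnW.
rewrite -(subrK q p); apply: (GD) => //; apply: IHn.
  apply/leq_sizeP => j; rewrite leq_eqVlt => /orP[/eqP <- | lt_nj].
    by rewrite coefB qn subrr.
  by rewrite coefB !nth_default ?subrr // (leq_trans _ lt_nj).
apply: ideal_sub => //; exact: gen_min gq.
Qed.

Lemma noetherian_surj (R S : comPzRingType) (h : {rmorphism R -> S}) :
  noetherian R -> (forall y, exists x, h x = y) -> noetherian S.
Proof.
move=> noeR surj I idI; have [I0 ID IM] := idI.
have [s Hs] : exists s : seq R, forall x, I (h x) <-> in_ideal_gen s x.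
  apply: noeR; split; first by rewrite rmorph0.
  - by move=> x y Ix Iy; rewrite rmorphD; apply: ID.
  - by move=> r x Ix; rewrite rmorphM; apply: IM.
exists (map h s) => y; split=> [Iy | ].
  have [x xy] := surj y; move: Iy; rewrite -xy => /Hs gx.
  have idG := ideal_gen _ (map h s); have [_ _ GM] := idG.
  case: gx => c ->; rewrite rmorph_sum; apply: ideal_sum => // i.
  by rewrite rmorphM; apply: GM; apply: mem_gen; apply: map_f; apply: mem_nth.
move=> gy; apply: (gen_min _ _ _ y idI _ gy).
by move=> z /mapP[x xs ->]; apply/Hs; apply: mem_gen.
Qed.

Lemma mpoly_closed_ind (R : comNzRingType) (n : nat) (K : {mpoly R[n]} -> Prop) :
  (forall c, K c%:MP) -> (forall i, K 'X_i) ->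
  (forall p q, K p -> K q -> K (p + q)) -> (forall p q, K p -> K q -> K (p * q)) ->
  forall p, K p.
Proof.
move=> KC KX KD KM p.
have K1 : K 1 by rewrite -mpolyC1.
rewrite [p]mpolyE; apply: (big_ind K) => // [|m _]; first by rewrite -mpolyC0.
rewrite -mul_mpolyC; apply: (KM) => //; rewrite mpolyXE_id.
apply: (big_ind K) => // i _; elim: (m i) => [|d IHd]; first by rewrite expr0.
by rewrite exprS; apply: KM.
Qed.

Lemma noetherian_mpoly (R : comNzRingType) (n : nat) :
  noetherian R -> noetherian {mpoly R[n]}.
Proof.
move=> noeR; elim: n => [|n IHn].
  apply: (noetherian_surj _ _ (@mpolyC 0 R) noeR) => p.
  elim/mpoly_closed_ind: p => [c | [] // | _ _ [a <-] [b <-] | _ _ [a <-] [b <-]];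
    [by exists c | exists (a + b); exact: rmorphD | exists (a * b); exact: rmorphM].
have comX : commr_rmorph (@mwiden n R) 'X_ord_max by move=> p; apply: mulrC.
(* [{mpoly R[n.+1]}] is the image of [{poly {mpoly R[n]}}]. *)
apply: (noetherian_surj _ _ (horner_morph comX) (noetherian_poly _ IHn)) => p.
elim/mpoly_closed_ind: p => [c | i | _ _ [a <-] [b <-] | _ _ [a <-] [b <-]].
- exists (c%:MP)%:P; rewrite -(mwidenC _ c); exact: horner_morphC.
- case: (unliftP ord_max i) => [j -> | ->]; last by exists 'X; exact: horner_morphX.
  exists ('X_j)%:P; transitivity (mwiden ('X_j : {mpoly R[n]})); first exact: horner_morphC.
  rewrite mwidenX mnmwiden1; congr 'X__.
  by apply/val_inj => /=; rewrite /bump leqNgt ltn_ord.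
- by exists (a + b); exact: rmorphD.
- by exists (a * b); exact: rmorphM.
Qed.

(** * The evaluation homomorphism of a presentation *)

Section Peval.
Variables (B : comNzRingType) (A : comPzRingType) (f : {rmorphism B -> A}).
Variables (n : nat) (v : 'I_n -> A).
Local Notation P := {mpoly B[n]}.

Lemma peval_rmorphism : [/\ zmod_morphism (peval f v), monoid_morphism (peval f v),
  forall b, peval f v b%:MP = f b & forall i, peval f v 'X_i = v i].
Proof.
(* [mmap] requires a nontrivial codomain. *)
have [A0 | A1] := eqVneq (1 : A) 0.
  have triv (x y : A) : x = y by rewrite -[x]mul1r -[y]mul1r A0 !mul0r.
  by do ?split; move=> *; apply: triv.
pose A' : comNzRingType := HB.pack (GRing.ComPzRing.sort A)
  (GRing.ComPzRing.class A) (GRing.PzSemiRing_isNonZero.Build (GRing.ComPzRing.sort A) A1).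
pose f' : {rmorphism B -> A'} := f.
pose v' : 'I_n -> A' := v.
split.
- exact: (rmorphB (mmap f' v')).
- split; [exact: (rmorph1 (mmap f' v')) | exact: (rmorphM (mmap f' v'))].
- exact: (mmapC v' f').
- by move=> i; have := mmapX v' f' U_(i)%MM; rewrite mmap1U.
Qed.

Lemma peval_zmod_morphism : zmod_morphism (peval f v).
Proof. by case: peval_rmorphism. Qed.

Lemma peval_monoid_morphism : monoid_morphism (peval f v).
Proof. by case: peval_rmorphism. Qed.

HB.instance Definition _ := GRing.isZmodMorphism.Build P A (peval f v) peval_zmod_morphism.
HB.instance Definition _ := GRing.isMonoidMorphism.Build P A (peval f v) peval_monoid_morphism.

Lemma pevalC b : peval f v b%:MP = f b.
Proof. by case: peval_rmorphism. Qed.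

Lemma pevalX i : peval f v 'X_i = v i.
Proof. by case: peval_rmorphism. Qed.

End Peval.

(** * Lifting homomorphisms on J to derivations *)

Section Derivations.
Variables (B : comNzRingType) (A : comPzRingType) (f : {rmorphism B -> A}).
Variables (n : nat) (v : 'I_n -> A).
Local Notation P := {mpoly B[n]}.
Local Notation pi := (peval f v).

Lemma der0 : is_der f v (fun=> 0).
Proof. by split=> *; ring. Qed.

Lemma derD D E : is_der f v D -> is_der f v E -> is_der f v (fun p => D p + E p).
Proof.
by move=> [D1 D2 D3] [E1 E2 E3]; split=> *;
  [rewrite D1 E1 | rewrite D2 E2 | rewrite D3 E3]; ring.
Qed.

Lemma derZ a D : is_der f v D -> is_der f v (fun p => a * D p).
Proof. by move=> [D1 D2 D3]; split=> *; [rewrite D1 | rewrite D2 | rewrite D3]; ring. Qed.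

Lemma derC D b : is_der f v D -> D b%:MP = 0.
Proof.
case=> _ DM DC; have D1 : D 1 = 0.
  have := DM 1 1; rewrite mulr1 rmorph1 mul1r => D11.
  by apply: (addrI (D 1)); rewrite addr0 -D11.
by rewrite -[b%:MP]mulr1 DC D1 mulr0.
Qed.

End Derivations.

Section Lifting.
Variables (B : comNzRingType) (A : comPzRingType) (f : {rmorphism B -> A}).
Variables (n : nat) (v : 'I_n -> A).
Local Notation P := {mpoly B[n]}.
Local Notation pi := (peval f v).
Variables (m : nat) (F : 'I_m -> P).
Hypothesis pres : presentation f v.
Hypothesis FJ : forall i, pi (F i) = 0.
Hypothesis genJ : forall j, pi j = 0 -> exists c : 'I_m -> P, j = \sum_i c i * F i.

Definition syzygy (p : 'I_m -> P) : Prop := \sum_i p i * F i = 0.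

(** Only the image of the syzygies in A^m matters. It is an A-submodule because [pi] is onto, hence
    finitely generated, and the columns of [T] are generators. The u with u T = 0 are then the
    values on the [F i] of the elements of Hom_A(J, A). *)
Lemma syzygy_matrix : noetherian A ->
  exists q (T : 'M[A]_(m, q)),
    (forall l, exists2 p, syzygy p & forall i, T i l = pi (p i)) /\
    (forall u : 'rV_m, u *m T = 0 -> forall p, syzygy p -> \sum_i pi (p i) * u 0 i = 0).
Proof.
move=> noeA.
pose S (x : 'rV[A]_m) := exists2 p, syzygy p & x = \row_i pi (p i).
have [| | |q [M [SM HM]]] := @noetherian_submodule _ _ S noeA.
- exists (fun=> 0); first by rewrite /syzygy big1 // => i _; rewrite mul0r.
  by apply/rowP => i; rewrite !mxE rmorph0.
- move=> _ _ [p Hp ->] [r Hr ->]; exists (fun i => p i + r i).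
    transitivity (\sum_i p i * F i + \sum_i r i * F i); last by rewrite Hp Hr addr0.
    by rewrite -big_split; apply: eq_bigr => i _; rewrite mulrDl.
  by apply/rowP => i; rewrite !mxE rmorphD.
- move=> a _ [p Hp ->]; have [b <-] := pres a.
  exists (fun i => b * p i); last by apply/rowP => i; rewrite !mxE rmorphM.
  transitivity (b * \sum_i p i * F i); last by rewrite Hp mulr0.
  by rewrite mulr_sumr; apply: eq_bigr => i _; rewrite mulrA.
exists q, M^T; split=> [l | u uT p Hp].
  have [p Hp Mp] := SM l; exists p => // i.
  by rewrite mxE; move/rowP: Mp => /(_ i); rewrite !mxE.
have [c Hc] : exists c : 'rV_q, \row_i pi (p i) = c *m M by apply: HM; exists p.
have : (u *m (c *m M)^T) 0 0 = 0 by rewrite trmx_mul mulmxA uT mul0mx mxE.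
rewrite mxE -Hc => E; etransitivity; last exact: E.
by apply: eq_bigr => i _; rewrite !mxE mulrC.
Qed.

(** Since the [F i] generate J, prescribing values on them that respect the syzygies is the same as
    giving an element of Hom_A(J, A). *)
Lemma syzygy_hom (x : 'I_m -> A) :
  (forall p, syzygy p -> \sum_i pi (p i) * x i = 0) ->
  exists phi, is_homJ f v phi /\ forall i, phi (F i) = x i.
Proof.
move=> Hx.
have [c Hc] : exists c : P -> 'I_m -> P, forall j, pi j = 0 -> j = \sum_i c j i * F i.
  apply: (fun_choice _ _ (fun j c => pi j = 0 -> j = \sum_i c i * F i)) => j.
  have [/genJ[c ->] | nJ] := classic (pi j = 0); first by exists c.
  by exists (fun=> 0).
pose phi j := \sum_i pi (c j i) * x i.
(* The value does not depend on the chosen expression of j, as two expressions differ by a syzygy.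
   Additivity and linearity then follow by exhibiting a suitable expression. *)
have phiE j (p : 'I_m -> P) : j = \sum_i p i * F i -> phi j = \sum_i pi (p i) * x i.
  move=> jE; have Jj : pi j = 0.
    by rewrite jE rmorph_sum big1 // => i _; rewrite rmorphM /= FJ mulr0.
  apply/eqP; rewrite -subr_eq0 -sumrB; apply/eqP.
  rewrite -[RHS](Hx (fun i => c j i - p i)).
    by apply: eq_bigr => i _; rewrite rmorphB mulrBl.
  rewrite /syzygy; transitivity (\sum_i c j i * F i - \sum_i p i * F i).
    by rewrite -sumrB; apply: eq_bigr => i _; rewrite mulrBl.
  by rewrite -jE -Hc // subrr.
exists phi; split; last first.
  move=> i; rewrite (phiE _ (fun l => (l == i)%:R)).
    rewrite (bigD1 i) //= eqxx rmorph1 mul1r big1 ?addr0 // => l /negPf ->.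
    by rewrite rmorph0 mul0r.
  by rewrite (bigD1 i) //= eqxx mul1r big1 ?addr0 // => l /negPf ->; rewrite mul0r.
split=> [j1 j2 J1 J2 | p j Jj].
  rewrite (phiE _ (fun i => c j1 i + c j2 i)).
    by rewrite -big_split; apply: eq_bigr => i _; rewrite rmorphD mulrDl.
  rewrite {1}(Hc _ J1) {1}(Hc _ J2) -big_split.
  by apply: eq_bigr => i _; rewrite mulrDl.
rewrite (phiE _ (fun i => p * c j i)).
  by rewrite mulr_sumr; apply: eq_bigr => i _; rewrite rmorphM mulrA.
by rewrite {1}(Hc _ Jj) mulr_sumr; apply: eq_bigr => i _; rewrite mulrA.
Qed.

(** Hom_A(J, A) embeds in A^m by values on the [F i], so it is finitely generated. One power of [g]
    works for each generator, the largest for all of them, and A-linear combinations of derivations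
    are derivations. *)
Lemma derivation_bound (g : A) : noetherian A -> T1_support_in f v g ->
  exists N, forall x : 'I_m -> A, (forall p, syzygy p -> \sum_i pi (p i) * x i = 0) ->
    exists D, is_der f v D /\ forall i, D (F i) = g ^+ N * x i.
Proof.
move=> noeA T1g.
pose C (x : 'rV[A]_m) := forall p, syzygy p -> \sum_i pi (p i) * x 0 i = 0.
have [| | |q [M [CM HM]]] := @noetherian_submodule _ _ C noeA.
- by move=> p _; rewrite big1 // => i _; rewrite mxE mulr0.
- move=> x y Cx Cy p Hp.
  transitivity (\sum_i pi (p i) * x 0 i + \sum_i pi (p i) * y 0 i).
    by rewrite -big_split; apply: eq_bigr => i _; rewrite mxE mulrDr.
  by rewrite Cx // Cy // addr0.
- move=> a x Cx p Hp.
  transitivity (a * \sum_i pi (p i) * x 0 i); last by rewrite Cx // mulr0.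
  by rewrite mulr_sumr; apply: eq_bigr => i _; rewrite mxE mulrCA.
pose K l N := exists D, is_der f v D /\ forall i, D (F i) = g ^+ N * M l i.
have [N HN] : exists N, forall l, K l N.
  apply: uniform_bound => [l a b le_ab [D [derD DF]] | l].
    exists (fun p => g ^+ (b - a) * D p); split=> [|i]; first exact: derZ.
    by rewrite DF mulrA -exprD subnK.
  have [|phi [homphi phiF]] := syzygy_hom (M l).
    by move=> p Hp; rewrite -[RHS](CM l p Hp); apply: eq_bigr => i _; rewrite mxE.
  (* The annihilator of the class of [phi] in T^1. The support hypothesis says exactly that no prime
     avoiding [g] contains it. *)
  pose I s := exists D, is_der f v D /\ forall j, pi j = 0 -> s * phi j = D j.
  have [N [D [derD DJ]]] : exists N, I (g ^+ N).
    apply: radical_of_primes => // [|r pr nrg].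
      split; first by exists (fun=> 0); split=> [|j _]; [exact: der0 | rewrite mul0r].
      - move=> x y [D [dD HD]] [E [dE HE]]; exists (fun p => D p + E p).
        by split=> [|j Jj]; [exact: derD | rewrite mulrDl HD // HE].
      - move=> a x [D [dD HD]]; exists (fun p => a * D p).
        by split=> [|j Jj]; [exact: derZ | rewrite -mulrA HD].
    exact: T1g.
  by exists N, D; split=> // i; rewrite -DJ // phiF.
have {}[D HD] := fun_choice _ _ _ HN.
exists N => x Hx.
have [c Hc] : exists c : 'rV_q, \row_i x i = c *m M.
  by apply: HM => p Hp; rewrite -[RHS](Hx p Hp); apply: eq_bigr => i _; rewrite mxE.
exists (fun p => \sum_l c 0 l * D l p); split.
  split=> [p r | p r | b p].
  - by rewrite -big_split; apply: eq_bigr => l _; case: (HD l) => -[-> _ _] _; rewrite mulrDr.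
  - rewrite !mulr_sumr -big_split; apply: eq_bigr => l _ /=.
    by case: (HD l) => -[_ -> _] _; ring.
  - by rewrite mulr_sumr; apply: eq_bigr => l _; case: (HD l) => -[_ _ ->] _; ring.
move=> i; move/rowP: Hc => /(_ i); rewrite !mxE => ->; rewrite mulr_sumr.
by apply: eq_bigr => l _; case: (HD l) => _ ->; ring.
Qed.

(* The obstruction to lifting [u] lives in [A^q / im T]; the bound [N] comes from
   the submodule of vectors with a [(tw)]-power multiple in [im T] being
   finitely generated. *)
Lemma torsion_bound (t w : A) : noetherian A ->
  exists N, forall k r (u : 'I_m -> A),
    (forall p, syzygy p -> in_pid (t ^+ k * w ^+ r) (\sum_i pi (p i) * u i)) ->
    exists u' : 'I_m -> A, forall p, syzygy p ->
      \sum_i pi (p i) * ((t * w) ^+ N * u i - t ^+ k * w ^+ r * u' i) = 0.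
Proof.
move=> noeA; have [q [T [TE HT]]] := syzygy_matrix noeA.
pose g := t * w.
pose S (y : 'rV[A]_q) := exists N u, g ^+ N *: y = u *m T.
have Smono N N' (y : 'rV_q) : (N <= N')%N -> (exists u : 'rV_m, g ^+ N *: y = u *m T) ->
    exists u : 'rV_m, g ^+ N' *: y = u *m T.
  move=> /subnK <- [u Hu]; exists (g ^+ (N' - N) *: u).
  by rewrite exprD -scalerA Hu scalemxAl.
have [| | |l [W [SW HW]]] := @noetherian_submodule _ _ S noeA.
- by exists 0%N, 0; rewrite scaler0 mul0mx.
- move=> x y [N [? Hx]] [N' [? Hy]]; exists (maxn N N').
  have [u Hu] := Smono _ _ _ (leq_maxl N N') (ex_intro _ _ Hx).
  have [u' Hu'] := Smono _ _ _ (leq_maxr N N') (ex_intro _ _ Hy).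
  by exists (u + u'); rewrite scalerDr Hu Hu' mulmxDl.
- move=> a x [N [u Hu]]; exists N, (a *: u).
  by rewrite scalerA mulrC -scalerA Hu scalemxAl.
have [N HN] : exists N, forall i, exists u, g ^+ N *: row i W = u *m T.
  by apply: uniform_bound => [i a b | i]; [apply: Smono | apply: SW].
have {}HN y : S y -> exists u, g ^+ N *: y = u *m T.
  have [U HU] := fun_choice _ _ _ HN.
  move=> /HW[c ->]; exists (\sum_i c 0 i *: U i).
  rewrite mulmx_sum_row scaler_sumr mulmx_suml; apply: eq_bigr => i _.
  by rewrite scalerA mulrC -scalerA HU scalemxAl.
exists N => k r u Hu; set d := t ^+ k * w ^+ r.
pose ur : 'rV_m := \row_i u i.
have [y Hy] : exists y : 'rV_q, ur *m T = d *: y.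
  have [y Hy] : exists y : 'I_q -> A, forall i, (ur *m T) 0 i = y i * d.
    apply: (fun_choice _ _ (fun i y => (ur *m T) 0 i = y * d)) => i.
    have [p Hp TiE] := TE i; have [y Hy] := Hu p Hp; exists y; rewrite -Hy mxE.
    by apply: eq_bigr => a _; rewrite TiE mxE mulrC.
  by exists (\row_i y i); apply/rowP => i; rewrite Hy !mxE mulrC.
(* [y] is in [S] because t^r w^k d = (tw)^(k+r), so (tw)^(k+r) y is the image under [T] of t^r w^k
   u. The exponent k+r only witnesses membership; the bound [N] was fixed before k and r. *)
have [u' Hu'] : exists u', g ^+ N *: y = u' *m T.
  apply: HN; exists (k + r)%N, (t ^+ r *: (w ^+ k *: ur)).
  rewrite -!scalemxAl Hy !scalerA /d /g; congr (_ *: _).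
  by rewrite exprMn !exprD; ring.
exists (fun i => u' 0 i) => p Hp.
rewrite -[RHS](HT (g ^+ N *: ur - d *: u') _ p Hp).
  by apply: eq_bigr => i _; rewrite !mxE.
by rewrite mulmxBl -!scalemxAl Hy -Hu' !scalerA mulrC subrr.
Qed.

(** The first power [N1] corrects [u] by a multiple of t^k w^r into an honest homomorphism on J; the
    second, [N2], makes that homomorphism the restriction of a derivation. *)
Lemma T1_lifting (t w : A) : noetherian A -> T1_support_in f v (t * w) ->
  exists N, forall k r (u : 'I_m -> A),
    (forall p, syzygy p -> in_pid (t ^+ k * w ^+ r) (\sum_i pi (p i) * u i)) ->
    exists D, is_der f v D /\
      forall i, in_pid (t ^+ k * w ^+ r) (D (F i) - (t * w) ^+ N * u i).
Proof.
move=> noeA T1g; have [N1 H1] := torsion_bound t w noeA.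
have [N2 H2] := derivation_bound (t * w) noeA T1g.
exists (N1 + N2)%N => k r u Hu; have [u' Hu'] := H1 k r u Hu.
have [D [derD DF]] := H2 _ Hu'; exists D; split=> // i.
by exists (- ((t * w) ^+ N2 * u' i)); rewrite DF exprD; ring.
Qed.

End Lifting.

(** * Flatness, principal ideals and Krull intersection *)

Section Flat.
Variables (B : comNzRingType) (A : comPzRingType) (f : {rmorphism B -> A}).

Lemma fcoef_sum (M : lmodType B) (h : M * A -> A) (s : seq (int * (M * A))) (L : seq (M * A)) :
  uniq L -> {subset [seq x.2 | x <- s] <= L} ->
  \sum_(x <- s) h x.2 *~ x.1 = \sum_(p <- L) h p *~ fcoef s p.
Proof.
move=> uL sL.
under [RHS]eq_bigr => p _ do rewrite /fcoef mulrz_sumr big_mkcond /=.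
rewrite exchange_big /=; apply: eq_big_seq => x xs.
rewrite (bigD1_seq x.2) //=; last by apply: sL; apply: map_f.
by rewrite eqxx big1 ?addr0 // => p /negPf; rewrite eq_sym => ->.
Qed.

(** Well-definedness of the multiplication map from B (x) A to A, which sends b (x) a to f(b) a. *)
Lemma tensor_zero_eval (s : seq (int * (B^o * A))) :
  tensor_zero f s -> \sum_(x <- s) (f x.2.1 * x.2.2) *~ x.1 = 0.
Proof.
case=> rs Hrs; pose h (p : B^o * A) := f p.1 * p.2.
(* A finite list carrying both [s] and all the relations, so that the coefficientwise identity can
   be summed and the sums exchanged. *)
pose L := undup ([seq x.2 | x <- s] ++ flatten [seq [seq y.2 | y <- tgen_sum f g.2] | g <- rs]).
have uL : uniq L by apply: undup_uniq.
rewrite (fcoef_sum _ h s L) // => [|p ps]; last by rewrite mem_undup mem_cat ps.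
under eq_bigr => p _ do rewrite Hrs mulrz_sumr.
rewrite exchange_big /=.
have : {subset flatten [seq [seq y.2 | y <- tgen_sum f g.2] | g <- rs] <= L}.
  by move=> p ps; rewrite mem_undup mem_cat ps orbT.
elim: rs {Hrs} L uL => [|g rs IHrs] L uL sL; first by rewrite big_nil.
rewrite big_cons IHrs // ?addr0; last first.
  by move=> p ps; apply: sL; rewrite /= mem_cat ps orbT.
under eq_bigr => p _ do rewrite mulrC mulrzA.
rewrite -mulrz_suml -(fcoef_sum _ h) //; last first.
  by move=> p ps; apply: sL; rewrite /= mem_cat ps.
case: g {IHrs sL} => a [m1 m2 b | m b1 b2 | b m c] /=;
  rewrite !big_cons big_nil /h /= ?mulr1z ?mulrN1z ?rmorphD ?[_ *: _]/(_ * _) ?rmorphM;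
  by rewrite -[RHS](mul0rz _ a); congr (_ *~ _); ring.
Qed.

Lemma flat_nzd (t : B) : flat f -> nzd t -> nzd (f t).
Proof.
move=> flf nzt a ta0.
have inj : injective ( *:%R t : {linear B^o -> B^o}).
  move=> x y /eqP; rewrite -subr_eq0 => /eqP E; apply/eqP; rewrite -subr_eq0; apply/eqP.
  by apply: nzt; rewrite mulrBr.
have /tensor_zero_eval : tensor_zero f [:: (1%:Z, ((1 : B^o), a))].
  (* [TScal] reduces (t, a) to (1, f t * a) = (1, 0); subtracting the relation for 0 + 0 = 0 removes
     the remaining symbol (1, 0), which is not formally zero. *)
  apply: flf inj _ _; exists [:: (1%:Z, TScal t (1 : B^o) a); (-1, TAddR (1 : B^o) 0 0)] => p.
  rewrite /fcoef /= !(big_cons, big_nil) /= ta0 !addr0.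
  by case: (_ == p); case: (_ == p); rewrite ?addr0 /=; ring.
by rewrite big_cons big_nil /= rmorph1 mul1r addr0 mulr1z.
Qed.

End Flat.

Section PrincipalIdeals.
Variable R : comPzRingType.
Implicit Types x y z a b t : R.

Lemma pid_trans x y a : in_pid x a -> in_pid y x -> in_pid y a.
Proof. by move=> [c ->] [d ->]; exists (c * d); rewrite mulrA. Qed.

Lemma pid_exp x i j : (i <= j)%N -> in_pid (x ^+ i) (x ^+ j).
Proof. by move=> ij; exists (x ^+ (j - i)); rewrite -exprD subnK. Qed.

Lemma pid_mul x y a b : in_pid x a -> in_pid y b -> in_pid (x * y) (a * b).
Proof. by move=> [c ->] [d ->]; exists (c * d); ring. Qed.

Lemma pid_exp_mul x y i i' j j' : (i <= i')%N -> (j <= j')%N ->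
  in_pid (x ^+ i * y ^+ j) (x ^+ i' * y ^+ j').
Proof. by move=> ? ?; apply: pid_mul; apply: pid_exp. Qed.

Lemma pidD x a b : in_pid x a -> in_pid x b -> in_pid x (a + b).
Proof. by case: (ideal_pid _ x) => _ + _; apply. Qed.

Lemma pidB x a b : in_pid x a -> in_pid x b -> in_pid x (a - b).
Proof. by move=> ? ?; apply: ideal_sub => //; apply: ideal_pid. Qed.

Lemma pidM x a b : in_pid x b -> in_pid x (a * b).
Proof. by case: (ideal_pid _ x) => _ _ +; apply. Qed.

Lemma pid0 x : in_pid x 0.
Proof. by case: (ideal_pid _ x). Qed.

Lemma nzdX t n : nzd t -> nzd (t ^+ n).
Proof.
move=> nzt; elim: n => [|n IHn] a; first by rewrite expr0 mul1r.
by rewrite exprS -mulrA => /nzt /IHn.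
Qed.

Lemma one_sub_exp u a n : exists b, (1 - u * a) ^+ n = 1 - u * b.
Proof.
elim: n => [|n [b Hb]]; first by exists 0; rewrite expr0; ring.
by exists (a + b - a * b * u); rewrite exprS Hb; ring.
Qed.

(* For [a] in the intersection write [a = t^m * s m]; the ascending chain of the
   ideals [(s m)] stabilises, giving [s n.+1 = c * t * s n.+1]. *)
Lemma krull_annihilator t : noetherian R -> nzd t ->
  exists c, forall x, (forall n, in_pid (t ^+ n) x) -> (1 - t * c) * x = 0.
Proof.
move=> noeR nzt; pose I x := forall n, in_pid (t ^+ n) x.
have idI : is_ideal I.
  split; first by move=> n; apply: pid0.
  - by move=> x y Ix Iy n; apply: pidD.
  - by move=> r x Ix n; apply: pidM.
(* As t is a non-zero-divisor, I = t I for the intersection I of all (t^n); iterating the division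
   gives the sequence [s] below. *)
have divI (x : {x | I x}) : exists y : {y | I y}, sval x = t * sval y.
  case: x => x Ix; have [y Hy] := Ix 1%N; rewrite expr1 mulrC in Hy.
  suff Iy : I y by exists (exist _ y Iy).
  move=> n; have [c Hc] := Ix n.+1; exists c; apply/eqP; rewrite -subr_eq0; apply/eqP.
  by apply: nzt; rewrite mulrBr -Hy Hc exprS; ring.
have [next Hnext] := fun_choice _ _ _ divI.
have one x : I x -> exists c, (1 - t * c) * x = 0.
  move=> Ix; pose s n := sval (iter n next (exist _ x Ix)).
  have sS n : s n = t * s n.+1 by rewrite /s Hnext.
  have [n Hn] : exists n, forall m y, in_pid (s m) y -> in_pid (s n) y.
    apply: noetherian_acc => // [n | n y [c ->]]; first exact: ideal_pid.
    by exists (c * t); rewrite sS mulrA.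
  have [|c Hc] := Hn n.+1 (s n.+1); first by exists 1; rewrite mul1r.
  have xE m : x = t ^+ m * s m.
    elim: m => [|m {1}->]; first by rewrite expr0 mul1r.
    by rewrite sS exprS; ring.
  exists c; rewrite (xE n.+1) mulrCA [X in _ * X](_ : _ = 0) ?mulr0 //.
  by rewrite (sS n) in Hc; rewrite mulrBl mul1r {1}Hc; ring.
have [s Hs] := noeR _ idI.
have [c Hc] : exists c, forall x, x \in s -> (1 - t * c) * x = 0.
  have sI x : x \in s -> I x by move=> xs; apply/Hs; apply: mem_gen.
  elim: s sI {Hs} => [|y s IHs] sI; first by exists 0.
  have [|c Hc] := IHs; first by move=> x xs; apply: sI; rewrite in_cons xs orbT.
  have [|d Hd] := one y; first by apply: sI; rewrite in_cons eqxx.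
  exists (c + d - c * d * t) => x.
  have -> : 1 - t * (c + d - c * d * t) = (1 - t * c) * (1 - t * d) by ring.
  rewrite in_cons => /orP[/eqP-> | /Hc xs]; first by rewrite -mulrA Hd mulr0.
  by rewrite mulrAC xs mul0r.
exists c => x /Hs; apply: (gen_min _ (fun x => (1 - t * c) * x = 0)) => //.
split; first exact: mulr0.
- by move=> a b Ha Hb; rewrite mulrDr Ha Hb addr0.
- by move=> a b Hb; rewrite mulrCA Hb mulr0.
Qed.

End PrincipalIdeals.

(** * Improving an approximation *)

Lemma regular_exp (R : comPzRingType) (t w : R) (r : nat) :
  (forall a, in_pid (w ^+ r) (t * a) -> in_pid (w ^+ r) a) ->
  forall n a, in_pid (w ^+ r) (t ^+ n * a) -> in_pid (w ^+ r) a.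
Proof.
move=> reg; elim=> [|n IHn] a; first by rewrite expr0 mul1r.
by rewrite exprS -mulrA => /reg /IHn.
Qed.

Lemma union_ideal (R : comPzRingType) (t w : R) (k r : nat) :
  is_ideal (in_union_ideal t w k r).
Proof.
split; first by split; apply: pid0.
- by move=> x y [? ?] [? ?]; split; apply: pidD.
- by move=> a x [? ?]; split; apply: pidM.
Qed.

(** Regularity of t modulo w^r makes the ideal of the union principal, so one can divide by its
    generator. *)
Lemma union_mul (R : comPzRingType) (t w : R) (k r : nat) :
  (forall a, in_pid (w ^+ r) (t * a) -> in_pid (w ^+ r) a) ->
  forall a, in_union_ideal t w k r a -> in_pid (t ^+ k * w ^+ r) a.
Proof.
move=> reg a [[c ->]]; rewrite mulrC => /(regular_exp _ _ _ _ reg)[d ->].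
by exists d; ring.
Qed.

Section Lift.
Variables (B : comNzRingType) (A A' : comPzRingType).
Variables (f : {rmorphism B -> A}) (f' : {rmorphism B -> A'}).
Variables (t : B) (w : A) (w' : A') (K r n : nat) (v : 'I_n -> A) (v' : 'I_n -> A').
Local Notation P := {mpoly B[n]}.
Local Notation T := (f t).
Local Notation T' := (f' t).
Local Notation pi := (peval f v).
Local Notation psi := (peval f' v').
Hypothesis nzT' : nzd T'.
Hypothesis reg : forall a, in_pid (w ^+ r) (T * a) -> in_pid (w ^+ r) a.
Hypothesis w_cancel : forall i a, (i < r)%N -> in_pid (w' ^+ i.+1) (w' * a) -> in_pid (w' ^+ i) a.
Hypothesis pres : presentation f v.
Hypothesis psiJ : forall j, pi j = 0 -> in_pid (T' ^+ K * w' ^+ r) (psi j).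
Hypothesis reflT : forall p, in_pid T' (psi p) -> in_pid T (pi p).
Hypothesis reflw : forall p, in_pid w' (psi p) -> in_pid w (pi p).
Hypothesis surj : forall x, exists p, in_pid (T' * w') (x - psi p).
Variables (om : P) (y : A').
Hypothesis pi_om : pi om = w.
Hypothesis psi_om : psi om = w' * (1 - T' * w' * y).

Lemma psi_tom_exp i : exists z,
  psi ((t%:MP * om) ^+ i) = (T' * w') ^+ i * (1 - T' * w' * z).
Proof.
have [z Hz] := one_sub_exp _ (T' * w') y i.
by exists z; rewrite rmorphXn rmorphM /= pevalC psi_om -Hz -exprMn mulrA.
Qed.

Lemma psi_congr p q : pi p = pi q -> in_pid (T' ^+ K * w' ^+ r) (psi p - psi q).
Proof. by move=> E; rewrite -rmorphB; apply: psiJ; rewrite rmorphB /= E subrr. Qed.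

(** Successive approximation: the error (T'w')^N c is corrected by q (t om)^N with psi q close to c,
    since psi (t om) is T'w' up to a factor that is 1 modulo T'w'. *)
Lemma psi_surj N x : exists p, in_pid ((T' * w') ^+ N) (x - psi p).
Proof.
elim: N => [|N [p [c Hc]]]; first by exists 0, (x - psi 0); rewrite expr0 mulr1.
have [q [d Hd]] := surj c; have [z Hz] := psi_tom_exp N.
exists (p + q * (t%:MP * om) ^+ N); rewrite rmorphD rmorphM /= Hz.
exists (d + psi q * z); rewrite opprD addrA Hc exprS.
have -> : c = psi q + d * (T' * w') by rewrite -Hd; ring.
by ring.
Qed.

Lemma psi_surj_union x : exists p, in_pid (T' ^+ K * w' ^+ r) (x - psi p).
Proof.
have [p Hp] := psi_surj (maxn K r) x; exists p; apply: pid_trans Hp _.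
by rewrite exprMn; apply: pid_exp_mul; [apply: leq_maxl | apply: leq_maxr].
Qed.

(** One factor of t is peeled off at a time: [reflT] gives pi p = T pi q, then psi p agrees with T'
    psi q modulo T'^K, and T' cancels. Only the case of exponent 1 comes from the given isomorphism,
    so K may exceed k. *)
Lemma psi_reflect_T i p : (i <= K)%N -> in_pid (T' ^+ i) (psi p) -> in_pid (T ^+ i) (pi p).
Proof.
elim: i p => [|i IHi] p iK H; first by exists (pi p); rewrite expr0 mulr1.
have [c Hc] : in_pid T (pi p).
  by apply: reflT; apply: pid_trans H _; rewrite -[X in in_pid X](expr1 T'); apply: pid_exp.
have [q Hq] := pres c.
have [e He] : in_pid (T' ^+ i) (psi q).
  have [d Hd] : in_pid (T' ^+ i.+1) (T' * psi q).
    have -> : T' * psi q = psi p - (psi p - psi (t%:MP * q)) by rewrite rmorphM /= pevalC; ring.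
    apply: pidB => //; apply: pid_trans (psi_congr _ _ _) _.
      by rewrite Hc rmorphM /= pevalC Hq mulrC.
    by rewrite -[X in in_pid X]mulr1 -(expr0 w'); apply: pid_exp_mul.
  exists d; apply/eqP; rewrite -subr_eq0; apply/eqP; apply: nzT'.
  by rewrite mulrBr Hd exprS; ring.
have [d Hd] : in_pid (T ^+ i) (pi q) by apply: IHi; [apply: ltnW | exists e].
by exists d; rewrite Hc -Hq Hd exprSr mulrA.
Qed.

(** 1 - w'z is a unit modulo w'^i. *)
Lemma unit_cancel z a i : in_pid (w' ^+ i) ((1 - w' * z) * a) -> in_pid (w' ^+ i) a.
Proof.
elim: i => [|i IHi] H; first by exists a; rewrite expr0 mulr1.
have [c Hc] : in_pid (w' ^+ i) a by apply: IHi; apply: pid_trans H _; apply: pid_exp.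
have -> : a = (1 - w' * z) * a + z * c * w' ^+ i.+1 by rewrite {2}Hc exprS {1}Hc; ring.
by apply: pidD => //; apply: pidM; exists 1; rewrite mul1r.
Qed.

Lemma psi_reflect_w i p : (i <= r)%N -> in_pid (w' ^+ i) (psi p) -> in_pid (w ^+ i) (pi p).
Proof.
elim: i p => [|i IHi] p ir H; first by exists (pi p); rewrite expr0 mulr1.
have [c Hc] : in_pid w (pi p).
  by apply: reflw; apply: pid_trans H _; rewrite -[X in in_pid X](expr1 w'); apply: pid_exp.
have [q Hq] := pres c.
have [e He] : in_pid (w' ^+ i) (psi q).
  apply: (unit_cancel (T' * y)); apply: w_cancel => //.
  have -> : w' * ((1 - w' * (T' * y)) * psi q) = psi p - (psi p - psi (om * q)).
    by rewrite rmorphM /= psi_om; ring.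
  apply: pidB => //; apply: pid_trans (psi_congr _ _ _) _.
    by rewrite Hc rmorphM /= pi_om Hq mulrC.
  by rewrite -[X in in_pid X]mul1r -(expr0 T'); apply: pid_exp_mul.
have [d Hd] : in_pid (w ^+ i) (pi q) by apply: IHi; [apply: ltnW | exists e].
by exists d; rewrite Hc -Hq Hd exprSr mulrA.
Qed.

(* Modulo [w'^r] this cannot be deduced from the [t]-adic statement, hence the
   two separate inductions above. *)
Lemma psi_reflect p : in_pid (T' ^+ K * w' ^+ r) (psi p) -> in_pid (T ^+ K * w ^+ r) (pi p).
Proof.
move=> [c Hc]; apply: (union_mul _ _ _ _ _ reg); split.
  by apply: psi_reflect_T => //; exists (c * w' ^+ r); rewrite Hc; ring.
by apply: psi_reflect_w => //; exists (c * T' ^+ K); rewrite Hc; ring.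
Qed.

Lemma psi_forward p : in_pid (T ^+ K * w ^+ r) (pi p) -> in_pid (T' ^+ K * w' ^+ r) (psi p).
Proof.
move=> [c Hc]; have [q Hq] := pres c.
rewrite -(subrK (psi (q * (t%:MP ^+ K * om ^+ r))) (psi p)); apply: pidD.
  by apply: psi_congr; rewrite Hc !(rmorphM, rmorphXn) /= pevalC pi_om Hq.
rewrite !(rmorphM, rmorphXn) /= pevalC psi_om exprMn.
by exists (psi q * (1 - T' * w' * y) ^+ r); ring.
Qed.

Section Step.
Variables (m : nat) (F : 'I_m -> P) (N : nat) (e : A').
Hypothesis FJ : forall i, pi (F i) = 0.
Hypothesis genJ : forall j, pi j = 0 -> exists c : 'I_m -> P, j = \sum_i c i * F i.
Hypothesis lifting : forall u : 'I_m -> A,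
  (forall p, syzygy _ _ _ F p -> in_pid (T ^+ K * w ^+ r) (\sum_i pi (p i) * u i)) ->
  exists D, is_der f v D /\
    forall i, in_pid (T ^+ K * w ^+ r) (D (F i) - (T * w) ^+ N * u i).
Hypotheses (leK : (N.*2 < K)%N) (ler : (N.*2 <= r)%N).
(* [w'] may be a zero divisor away from [V(t)]; the factor [1 - T' * e], a unit
   in the completion, makes up for it. *)
Hypothesis separated : forall x, w' ^+ r * x = 0 -> (1 - T' * e) * x = 0.

Lemma psi_improve : exists v'' : 'I_n -> A',
  (forall j, pi j = 0 -> in_pid (T' ^+ K.+1 * w' ^+ r) (peval f' v'' j)) /\
  (forall p, in_pid (T' ^+ (K - N) * w' ^+ (r - N)) (peval f' v'' p - psi p)).
Proof.
pose G := T' ^+ K * w' ^+ r; pose Q := T' ^+ K.+1 * w' ^+ r.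
pose E := T' ^+ (K - N) * w' ^+ (r - N).
have EG x : in_pid G x -> in_pid Q (E * x).
  move=> Gx; have : in_pid (E * G) (E * x) by apply: pid_mul => //; exists 1; rewrite mul1r.
  move/pid_trans; apply; rewrite /E /G mulrACA -!exprD; apply: pid_exp_mul; lia.
(* This is where 2N < K and 2N <= r are needed: the quadratic Taylor terms disappear modulo [Q]. *)
have EE x : in_pid Q (E * E * x).
  rewrite mulrC; apply: pidM; rewrite /E mulrACA -!exprD; apply: pid_exp_mul; lia.
have EGN : E * (T' * w') ^+ N = G.
  by rewrite /E /G exprMn mulrACA -!exprD !subnK //; lia.
have [th Hth] : exists th, forall i, psi (F i) = th i * G.
  by apply: (fun_choice _ _ (fun i th => psi (F i) = th * G)) => i; apply: psiJ.
pose e1 := 1 - T' * e.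
(* The quotients [th i] live in A', so they are pulled back to P modulo [G], after multiplication by
   [e1], which makes the syzygy relations hold exactly in A'. *)
have [U HU] : exists U, forall i, in_pid G (e1 * th i - psi (U i)).
  apply: (fun_choice _ _ (fun i U => in_pid G (e1 * th i - psi U))) => i.
  exact: psi_surj_union.
have [|D [derD DF]] := lifting (fun i => pi (U i)).
  move=> p syz; under eq_bigr => i _ do rewrite -rmorphM.
  rewrite -rmorph_sum; apply: psi_reflect.
  have E0 : e1 * (\sum_i psi (p i) * th i) = 0.
    apply: separated; apply: (nzdX _ _ K nzT').
    have : psi (\sum_i p i * F i) = 0 by rewrite syz rmorph0.
    rewrite rmorph_sum => H; etransitivity; last exact: H.
    by rewrite mulrA mulr_sumr; apply: eq_bigr => i _; rewrite rmorphM /= Hth /G; ring.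
  rewrite rmorph_sum /= -[X in in_pid _ X]subr0 -[X in in_pid _ (_ - X)]E0 mulr_sumr -sumrB.
  apply: (big_ind (in_pid G)) => [|a b|i _]; [exact: pid0 | exact: pidD |].
  rewrite rmorphM /= [X in in_pid _ X](_ : _ = - psi (p i) * (e1 * th i - psi (U i))); last by ring.
  exact: pidM.
(* [la] is an arbitrary, not even additive, lift of [D] to P. Its image under psi is determined
   modulo [G], and E G lies in [Q], so the choice is harmless. *)
have [la Hla] : exists la, forall p, pi (la p) = D p.
  by apply: (fun_choice _ _ (fun p q => pi q = D p)) => p; apply: pres.
pose v'' i := v' i - E * psi (la 'X_i).
have [DD DM DC] := derD.
(* Taylor expansion of [psi - E * D], to first order in [E] *)
have taylor p : in_pid Q (peval f' v'' p - psi p + E * psi (la p)).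
  elim/mpoly_closed_ind: p => [c | i | p q Hp Hq | p q Hp Hq].
  - rewrite !pevalC subrr add0r; apply: EG; apply: psiJ.
    by rewrite Hla (derC _ _ _ _ _ _ _ derD).
  - by rewrite !pevalX /v'' [X in in_pid _ X](_ : _ = 0); [exact: pid0 | ring].
  - rewrite !rmorphD /=.
    have H : in_pid G (psi (la (p + q)) - psi (la p + la q)).
      by apply: psi_congr; rewrite rmorphD /= !Hla DD.
    rewrite rmorphD /= in H.
    rewrite [X in in_pid _ X](_ : _ = (peval f' v'' p - psi p + E * psi (la p)) +
      (peval f' v'' q - psi q + E * psi (la q)) +
      E * (psi (la (p + q)) - (psi (la p) + psi (la q)))); last by ring.
    by apply: pidD; [apply: pidD | apply: EG].
  - rewrite !rmorphM /=.
    have H : in_pid G (psi (la (p * q)) - psi (p * la q + q * la p)).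
      by apply: psi_congr; rewrite rmorphD !rmorphM /= !Hla DM.
    rewrite rmorphD !rmorphM /= in H.
    rewrite [X in in_pid _ X](_ : _ =
      peval f' v'' q * (peval f' v'' p - psi p + E * psi (la p)) +
      (psi p - E * psi (la p)) * (peval f' v'' q - psi q + E * psi (la q)) +
      E * (psi (la (p * q)) - (psi p * psi (la q) + psi q * psi (la p))) +
      E * E * (psi (la p) * psi (la q))); last by ring.
    by apply: pidD => //; apply: pidD; [apply: pidD; apply: pidM | apply: EG].
have QE : in_pid E Q by apply: pid_exp_mul; lia.
exists v''; split=> [j | p]; last first.
  rewrite [X in in_pid _ X](_ : _ = (peval f' v'' p - psi p + E * psi (la p)) - psi (la p) * E);
    last by ring.
  by apply: pidB; [apply: pid_trans QE | exists (psi (la p))].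
have FQ i : in_pid Q (peval f' v'' (F i)).
  have [z Hz] := psi_tom_exp N.
  have H1 : in_pid G (psi (la (F i)) - psi ((t%:MP * om) ^+ N * U i)).
    rewrite -rmorphB; apply: psi_forward.
    by rewrite rmorphB rmorphM rmorphXn rmorphM /= pevalC pi_om Hla.
  rewrite rmorphM /= Hz in H1.
  rewrite [X in in_pid _ X](_ : _ = (peval f' v'' (F i) - psi (F i) + E * psi (la (F i)))
     - E * (psi (la (F i)) - (T' * w') ^+ N * (1 - T' * w' * z) * psi (U i))
     + E * ((1 - T' * w' * z) * (T' * w') ^+ N * (e1 * th i - psi (U i)))
     + (psi (F i) - (1 - T' * w' * z) * (E * (T' * w') ^+ N) * e1 * th i)); last by ring.
  rewrite EGN; apply: pidD; last first.
    (* Both factors 1 - T'w'z and 1 - T'e are 1 modulo T', so what remains of G th_i after the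
       correction carries one more factor T'. *)
    exists ((e + z * w' - T' * w' * z * e) * th i).
    by rewrite Hth /Q /G /e1 exprS; ring.
  by apply: pidD; [apply: pidB => //; apply: EG | apply: EG; apply: pidM].
move=> /genJ[c ->]; rewrite -/Q rmorph_sum.
apply: (big_ind (in_pid Q)) => [|a b|i _]; [exact: pid0 | exact: pidD |].
by rewrite rmorphM; apply: pidM; apply: FQ.
Qed.
End Step.
End Lift.

(** * Passage to the completion *)

Section Limit.
Variables (B : comNzRingType) (A A' : comPzRingType).
Variables (f : {rmorphism B -> A}) (f' : {rmorphism B -> A'}).
Variables (t : B) (n : nat) (v : 'I_n -> A) (V : nat -> 'I_n -> A').
Local Notation P := {mpoly B[n]}.
Local Notation T := (f t).
Local Notation T' := (f' t).
Local Notation pi := (peval f v).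
Local Notation psi i := (peval f' (V i)).
Hypothesis psiJ : forall i j, pi j = 0 -> in_pid (T' ^+ i) (psi i j).
Hypothesis psiS : forall i p, in_pid (T' ^+ i) (psi i.+1 p - psi i p).
Hypothesis refl : forall i p, in_pid (T' ^+ i) (psi i p) -> in_pid (T ^+ i) (pi p).
Hypothesis surj : forall i x, exists p, in_pid (T' ^+ i) (x - psi i p).
Variable lift : A -> P.
Hypothesis liftK : forall a, pi (lift a) = a.

Lemma limit_congr i p q : in_pid (T ^+ i) (pi p - pi q) -> in_pid (T' ^+ i) (psi i p - psi i q).
Proof.
move=> [c Hc]; rewrite -rmorphB -[p - q](subrK (lift c * t%:MP ^+ i)) rmorphD; apply: pidD.
  by apply: psiJ; rewrite !rmorphB !(rmorphM, rmorphXn) /= pevalC liftK Hc subrr.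
by rewrite rmorphM rmorphXn /= pevalC; exists (psi i (lift c)).
Qed.

(** The limit is taken diagonally: term i uses the i-th approximation. Modulo T'^i this is a ring
    map independent of [lift], and [psiS] makes consecutive terms compatible. *)
Lemma compl_iso_limit : compl_iso f f' t (fun a i => psi i (lift (a i))).
Proof.
have eqC i p q : pi p = pi q -> in_pid (T' ^+ i) (psi i p - psi i q).
  by move=> E; apply: limit_congr; rewrite E subrr; apply: pid0.
split=> [a Ha i | ].
  rewrite -(subrK (psi i (lift (a i.+1))) (psi i.+1 _)) -addrA; apply: pidD => //.
  by apply: limit_congr; rewrite !liftK.
split=> [a c _ _ Hac i | ]; first by apply: limit_congr; rewrite !liftK.
split=> [a c _ _ i | ]; first by rewrite -rmorphD; apply: eqC; rewrite rmorphD /= !liftK.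
split=> [a c _ _ i | ]; first by rewrite -rmorphM; apply: eqC; rewrite rmorphM /= !liftK.
split=> [i | ]; first by have := eqC i (lift 1) 1; rewrite !rmorph1 liftK; apply.
split=> [b _ i | ]; first by have := eqC i (lift (f (b i))) (b i)%:MP; rewrite !pevalC liftK; apply.
split=> [a c _ _ H i | x Hx].
  by rewrite -[a i]liftK -[c i]liftK -rmorphB; apply: refl; rewrite rmorphB; apply: H.
have [p Hp] := fun_choice _ _ _ (fun i => surj i (x i)).
exists (fun i => pi (p i)); split=> i.
  rewrite -rmorphB; apply: refl; rewrite rmorphB /=.
  have Hp1 : in_pid (T' ^+ i) (x i.+1 - psi i.+1 (p i.+1)).
    by apply: pid_trans (Hp i.+1) _; apply: pid_exp.
  have -> : psi i (p i.+1) - psi i (p i) =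
    (x i.+1 - x i) - (x i.+1 - psi i.+1 (p i.+1)) - (psi i.+1 (p i.+1) - psi i (p i.+1))
      + (x i - psi i (p i)) by ring.
  by apply: pidD => //; apply: pidB => //; apply: pidB.
rewrite -(subrK (psi i (p i)) (psi i _)) -addrA; apply: pidD.
  by apply: eqC; rewrite liftK.
by rewrite -opprB -mulN1r; apply: pidM.
Qed.

End Limit.

(** * Transfer of regularity along the given isomorphism, and construction of the completed one *)

Section QuotIso.
Variables (B : comNzRingType) (A A' : comPzRingType).
Variables (f : {rmorphism B -> A}) (f' : {rmorphism B -> A'}).
Variables (t : B) (w : A) (w' : A') (k r : nat) (phi : A -> A').
Local Notation T := (f t).
Local Notation T' := (f' t).
Hypothesis nzT' : nzd T'.
Hypothesis nzw : nzd w.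
Hypothesis reg : forall r a, in_pid (w ^+ r) (T * a) -> in_pid (w ^+ r) a.
Hypothesis iso : quot_iso f f' t w w' k r phi.
Hypotheses (k0 : (0 < k)%N) (r0 : (0 < r)%N).
Local Notation I := (in_union_ideal T w k r).
Local Notation I' := (in_union_ideal T' w' k r).

Let I'0 : I' 0. Proof. by case: (union_ideal _ T' w' k r). Qed.
Let I'D x y : I' x -> I' y -> I' (x + y).
Proof. by case: (union_ideal _ T' w' k r) => _ + _; apply. Qed.
Let I'M a x : I' x -> I' (a * x).
Proof. by case: (union_ideal _ T' w' k r) => _ _; apply. Qed.
Let I'N x : I' x -> I' (- x).
Proof. by apply: ideal_opp; apply: union_ideal. Qed.

Let phiD a b : I' (phi (a + b) - (phi a + phi b)).
Proof. by case: iso => _ [H _]; apply: H. Qed.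
Let phiM a b : I' (phi (a * b) - phi a * phi b).
Proof. by case: iso => _ [_ [H _]]; apply: H. Qed.
Let phif b : I' (phi (f b) - f' b).
Proof. by case: iso => _ [_ [_ [_ [H _]]]]. Qed.
Let phi_inj a : I' (phi a) -> I a.
Proof. by case: iso => _ [_ [_ [_ [_ [H _]]]]]; apply: H. Qed.
Let phi_surj a' : exists a, I' (phi a - a').
Proof. by case: iso => _ [_ [_ [_ [_ [_ [H _]]]]]]; apply: H. Qed.
Let phiw : I' (phi w - w').
Proof. by case: iso => _ [_ [_ [_ [_ [_ [_ H]]]]]]. Qed.

Lemma iso_monomial i j a : I' (phi (T ^+ i * w ^+ j * a) - T' ^+ i * w' ^+ j * phi a).
Proof.
elim: i => [|i IHi]; last first.
  rewrite !exprS -!mulrA; move: IHi; rewrite -!mulrA => IHi.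
  set x := _ * (_ * a) in IHi *; set y := _ * (_ * phi a) in IHi *.
  have -> : phi (T * x) - T' * y =
    (phi (T * x) - phi T * phi x) + phi x * (phi T - T') + T' * (phi x - y) by ring.
  by apply: I'D; [apply: I'D|] => //; apply: I'M.
rewrite !expr0 !mul1r; elim: j => [|j IHj]; first by rewrite !expr0 !mul1r subrr.
rewrite !exprS -!mulrA; set x := _ * a in IHj *; set y := _ * phi a in IHj *.
have -> : phi (w * x) - w' * y =
  (phi (w * x) - phi w * phi x) + phi x * (phi w - w') + w' * (phi x - y) by ring.
by apply: I'D; [apply: I'D|] => //; apply: I'M.
Qed.

(** Surjectivity replaces the cofactor c' by some phi c, so a - T^i w^j c is in [I], hence in (T^k
    w^r), which the bounds on i and j place inside (T^i w^j). *)
Lemma iso_reflect i j a : (i <= k)%N -> (j <= r)%N ->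
  in_pid (T' ^+ i * w' ^+ j) (phi a) -> in_pid (T ^+ i * w ^+ j) a.
Proof.
move=> ik jr [c' Hc']; have [c Hc] := phi_surj c'.
pose b := T ^+ i * w ^+ j * c.
have : I (a - b).
  apply: phi_inj.
  have -> : phi (a - b) = - (phi (a - b + b) - (phi (a - b) + phi b)) -
     (phi b - T' ^+ i * w' ^+ j * phi c) - T' ^+ i * w' ^+ j * (phi c - c').
    by rewrite subrK Hc'; ring.
  by apply: I'D; [apply: I'D|]; apply: I'N => //; [apply: iso_monomial | apply: I'M].
move/(union_mul _ _ _ _ _ (reg r)) => Iab.
rewrite -(subrK b a); apply: pidD; last by exists c; rewrite mulrC.
by apply: pid_trans Iab _; apply: pid_exp_mul.
Qed.

Lemma iso_regular a' : in_pid (w' ^+ r) (T' * a') -> in_pid (w' ^+ r) a'.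
Proof.
move=> H; have [a Ha] := phi_surj a'; have [_ Haw] := Ha.
have : in_pid (T ^+ 0 * w ^+ r) (T * a).
  apply: iso_reflect => //; rewrite expr0 mul1r.
  have [_ E] := iso_monomial 1 0 a; rewrite !expr0 !expr1 !mulr1 in E.
  have -> : phi (T * a) = (phi (T * a) - T' * phi a) + T' * (phi a - a') + T' * a' by ring.
  by apply: pidD; [apply: pidD|] => //; apply: pidM.
rewrite expr0 mul1r => /reg[c Hc]; rewrite Hc in Haw.
have [_ E] := iso_monomial 0 r c; rewrite expr0 !mul1r in E.
have -> : a' = - (phi (c * w ^+ r) - a') + (phi (w ^+ r * c) - w' ^+ r * phi c)
    + phi c * w' ^+ r by rewrite [w ^+ r * c]mulrC; ring.
by apply: pidD; [apply: pidD => //; rewrite -mulN1r; apply: pidM | exists (phi c)].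
Qed.

Lemma iso_union a' : I' a' -> in_pid (T' ^+ k * w' ^+ r) a'.
Proof. exact: (union_mul _ _ _ _ _ iso_regular). Qed.

(** Inherited from w being a non-zero-divisor on A; the scheme Z'_r sees powers of [w'] only up to
    r, hence i+1 <= r. *)
Lemma iso_w_cancel i a' : (i < r)%N ->
  in_pid (w' ^+ i.+1) (w' * a') -> in_pid (w' ^+ i) a'.
Proof.
move=> ir H; have [a Ha] := phi_surj a'; have [_ Haw] := Ha.
have {}Haw : in_pid (w' ^+ i) (phi a - a').
  by apply: pid_trans Haw _; apply: pid_exp; apply: ltnW.
have : in_pid (T ^+ 0 * w ^+ i.+1) (w * a).
  apply: iso_reflect => //; rewrite expr0 mul1r.
  have [_ E] := iso_monomial 0 1 a; rewrite !expr0 !expr1 !mul1r in E.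
  have -> : phi (w * a) = (phi (w * a) - w' * phi a) + (phi a - a') * w' + w' * a' by ring.
  apply: pidD; [apply: pidD|] => //; first by apply: pid_trans E _; apply: pid_exp.
  by rewrite exprSr; apply: pid_mul => //; exists 1; rewrite mul1r.
rewrite expr0 mul1r => -[c Hc].
have {}Hc : a = c * w ^+ i.
  apply/eqP; rewrite -subr_eq0; apply/eqP; apply: nzw.
  by rewrite mulrBr Hc exprS; ring.
have [_ E] := iso_monomial 0 i c; rewrite expr0 !mul1r in E.
have -> : a' = - (phi a - a') + (phi (w ^+ i * c) - w' ^+ i * phi c) + phi c * w' ^+ i.
  by rewrite {1}Hc [w ^+ i * c]mulrC; ring.
apply: pidD; last by exists (phi c).
apply: pidD; first by rewrite -mulN1r; apply: pidM.
by apply: pid_trans E _; apply: pid_exp; apply: ltnW.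
Qed.

(** Modulo t, regularity of [w'] follows from that of w: if w a = T c then c is in (w) by [reg], so
    a is in (T). Higher powers follow by cancelling T', without the bound n <= k. *)
Lemma iso_w_T_cancel n a' : in_pid (T' ^+ n) (w' * a') -> in_pid (T' ^+ n) a'.
Proof.
elim: n a' => [|n IHn] a' H; first by exists a'; rewrite expr0 mulr1.
have [b Hb] : in_pid T' a'.
  have [a Ha] := phi_surj a'; have [Hat _] := Ha.
  have kT x : in_pid (T' ^+ k) x -> in_pid T' x.
    by move=> H'; apply: pid_trans H' _; rewrite -[X in in_pid X](expr1 T'); apply: pid_exp.
  have [c Hc] : in_pid T (w * a).
    have := iso_reflect 1 0 (w * a) k0 (leq0n r); rewrite !expr0 !mulr1 !expr1; apply.
    have [E _] := iso_monomial 0 1 a; rewrite !expr0 !expr1 !mul1r in E.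
    have -> : phi (w * a) = (phi (w * a) - w' * phi a) + w' * (phi a - a') + w' * a' by ring.
    apply: pidD; [apply: pidD|]; [exact: kT | by apply: pidM; apply: kT |].
    by apply: pid_trans H _; rewrite -[X in in_pid X](expr1 T'); apply: pid_exp.
  have [d Hd] : in_pid (w ^+ 1) c.
    by apply: reg; exists a; rewrite expr1 mulrC -Hc mulrC.
  have aE : a = T * d.
    apply/eqP; rewrite -subr_eq0; apply/eqP; apply: nzw.
    by rewrite mulrBr Hc Hd expr1; ring.
  have [E _] := iso_monomial 1 0 d; rewrite !expr0 !expr1 !mulr1 in E.
  have -> : a' = - (phi a - a') + (phi (T * d) - T' * phi d) + phi d * T'.
    by rewrite aE; ring.
  apply: pidD; last by exists (phi d).
  by apply: pidD; [rewrite -mulN1r; apply: pidM|]; apply: kT.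
have [d Hd] : in_pid (T' ^+ n) b.
  apply: IHn; have [c Hc] := H; exists c; apply/eqP; rewrite -subr_eq0; apply/eqP.
  apply: nzT'; rewrite mulrBr [T' * (c * _)]mulrCA -exprS -Hc Hb; ring.
by exists d; rewrite Hb Hd exprSr mulrA.
Qed.

Lemma iso_T_separated x : w' ^+ r * x = 0 -> forall n, in_pid (T' ^+ n) x.
Proof.
move=> H n; have cancel i : in_pid (T' ^+ n) (w' ^+ i * x) -> in_pid (T' ^+ n) x.
  elim: i => [|i IHi]; first by rewrite expr0 mul1r.
  by rewrite exprS -mulrA => /iso_w_T_cancel.
by apply: (cancel r); rewrite H; apply: pid0.
Qed.

Section Approximation.
Variables (n : nat) (v : 'I_n -> A).
Local Notation P := {mpoly B[n]}.
Local Notation pi := (peval f v).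
Hypothesis pres : presentation f v.

Lemma initial_approximation p : I' (peval f' (fun i => phi (v i)) p - phi (pi p)).
Proof.
elim/mpoly_closed_ind: p => [c | i | p q Hp Hq | p q Hp Hq].
- by rewrite !pevalC -opprB; apply: I'N.
- by rewrite !pevalX subrr.
- rewrite !rmorphD /=.
  rewrite [X in I' X](_ : _ = (peval f' (fun i => phi (v i)) p - phi (pi p)) +
    (peval f' (fun i => phi (v i)) q - phi (pi q)) -
    (phi (pi p + pi q) - (phi (pi p) + phi (pi q)))); last by ring.
  by apply: I'D; [apply: I'D | apply: I'N].
- rewrite !rmorphM /=.
  rewrite [X in I' X](_ : _ =
    peval f' (fun i => phi (v i)) q * (peval f' (fun i => phi (v i)) p - phi (pi p)) +
    phi (pi p) * (peval f' (fun i => phi (v i)) q - phi (pi q)) -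
    (phi (pi p * pi q) - phi (pi p) * phi (pi q))); last by ring.
  by apply: I'D; [apply: I'D; apply: I'M | apply: I'N].
Qed.

Section Close.
Variable v' : 'I_n -> A'.
Local Notation psi := (peval f' v').
Hypothesis close : forall p, in_pid (T' * w' ^+ 2) (psi p - phi (pi p)).
Hypothesis r1 : (1 < r)%N.

Lemma close_reflect_T p : in_pid T' (psi p) -> in_pid T (pi p).
Proof.
move=> H; have := iso_reflect 1 0 (pi p) k0 (leq0n r); rewrite !expr0 !mulr1 !expr1; apply.
rewrite -[phi _](subKr (psi p)); apply: pidB => //.
by apply: pid_trans (close p) _; exists (w' ^+ 2); rewrite mulrC.
Qed.

Lemma close_reflect_w p : in_pid w' (psi p) -> in_pid w (pi p).
Proof.
move=> H; have := iso_reflect 0 1 (pi p) (leq0n k) r0; rewrite !expr0 !mul1r !expr1; apply.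
rewrite -[phi _](subKr (psi p)); apply: pidB => //.
by apply: pid_trans (close p) _; exists (T' * w'); ring.
Qed.

Let unionTw x : I' x -> in_pid (T' * w' ^+ 2) x.
Proof. by move/iso_union/pid_trans; apply; rewrite -{1}(expr1 T'); apply: pid_exp_mul. Qed.

Lemma close_surj x : exists p, in_pid (T' * w') (x - psi p).
Proof.
have [a /unionTw Ha] := phi_surj x; have [p Hp] := pres a; exists p.
apply: (pid_trans _ (T' * w' ^+ 2)); last by exists w'; ring.
rewrite [X in in_pid _ X](_ : _ = - 1 * (phi a - x) - (psi p - phi (pi p))); last by rewrite Hp; ring.
by apply: pidB => //; apply: pidM.
Qed.

(** Closeness is required modulo T' w'^2 rather than T' w' so that psi om is [w'] times a factor
    that is 1 modulo T'w'. *)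
Lemma close_w : exists om y, pi om = w /\ psi om = w' * (1 - T' * w' * y).
Proof.
have [om Hom] := pres w; have [c Hc] : in_pid (T' * w' ^+ 2) (psi om - w').
  rewrite -(subrK (phi (pi om)) (psi om)) -addrA; apply: pidD => //.
  by rewrite Hom; apply: unionTw.
exists om, (- c); split=> //.
by rewrite -(subrK w' (psi om)) Hc; ring.
Qed.

End Close.

Lemma completion_iso (m : nat) (F : 'I_m -> P) (N : nat) (e : A') :
  (forall j, pi j = 0 -> exists c : 'I_m -> P, j = \sum_i c i * F i) ->
  (forall i, pi (F i) = 0) ->
  (forall K (u : 'I_m -> A),
    (forall p, syzygy _ _ _ F p -> in_pid (T ^+ K * w ^+ r) (\sum_i pi (p i) * u i)) ->
    exists D, is_der f v D /\
      forall i, in_pid (T ^+ K * w ^+ r) (D (F i) - (T * w) ^+ N * u i)) ->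
  (forall x, (forall i, in_pid (T' ^+ i) x) -> (1 - T' * e) * x = 0) ->
  (N.*2 < k)%N -> (N.*2.+1 < r)%N ->
  exists Phi, compl_iso f f' t Phi /\
    forall a i, in_pid (T' ^+ (k - N) * w' ^+ (r - N)) (Phi a i - phi (a i)).
Proof.
move=> genJ FJ lifting sep leNk leNr.
(* The distance to [phi] is the same for all i: the first correction is the largest, and later ones
   lie in (T'^(k+i-N) w'^(r-N)). *)
pose Inv i v' := (forall j, pi j = 0 -> in_pid (T' ^+ (k + i) * w' ^+ r) (peval f' v' j)) /\
  (forall p, in_pid (T' ^+ (k - N) * w' ^+ (r - N)) (peval f' v' p - phi (pi p))).
have r1 : (1 < r)%N by lia.
have Inv_close i v' : Inv i v' -> forall p, in_pid (T' * w' ^+ 2) (peval f' v' p - phi (pi p)).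
  move=> [_ H] p; apply: pid_trans (H p) _.
  by rewrite -[X in X * w' ^+ 2](expr1 T'); apply: pid_exp_mul; lia.
have regr := reg r.
have step i v' : Inv i v' -> exists v'', Inv i.+1 v'' /\
    forall p, in_pid (T' ^+ (k + i - N) * w' ^+ (r - N)) (peval f' v'' p - peval f' v' p).
  move=> invv; have close := Inv_close i v' invv; have [vJ vphi] := invv.
  have [om [y [pi_om psi_om]]] := close_w v' close r1.
  have [|||v'' [HJ Hc]] := psi_improve _ _ _ f f' t w w' (k + i) r n v v' nzT' regr iso_w_cancel
    pres vJ (close_reflect_T v' close) (close_reflect_w v' close) (close_surj v' close r1)
    om y pi_om psi_om m F N e FJ genJ (lifting (k + i)%N) _ _ _.
  - lia.
  - lia.
  - by move=> x /iso_T_separated; apply: sep.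
  exists v''; split=> //; split=> [j Jj | p]; first by rewrite addnS; apply: HJ.
  rewrite -(subrK (peval f' v' p) (peval f' v'' p)) -addrA; apply: pidD => //.
  by apply: pid_trans (Hc p) _; apply: pid_exp_mul => //; lia.
have Inv0 : Inv 0%N (fun i => phi (v i)).
  split=> [j Jj | p].
    rewrite addn0; apply: iso_union; have := initial_approximation j; rewrite Jj => H.
    rewrite -(subrK (phi 0) (peval _ _ _)); apply: I'D => //.
    have := phiD 0 0; rewrite addr0 => H0.
    by rewrite [X in I' X](_ : _ = - (phi 0 - (phi 0 + phi 0))); [apply: I'N | ring].
  apply: pid_trans (iso_union _ (initial_approximation p)) _.
  by apply: pid_exp_mul; lia.
(* Choice needs a total function, so [next] returns its input where the invariant fails; the
   sequence [V] never meets that case. *)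
have [next Hnext] : exists next : nat * ('I_n -> A') -> 'I_n -> A', forall iv,
    Inv iv.1 iv.2 -> Inv iv.1.+1 (next iv) /\ forall p,
      in_pid (T' ^+ (k + iv.1 - N) * w' ^+ (r - N)) (peval f' (next iv) p - peval f' iv.2 p).
  apply: (fun_choice _ _ (fun iv v'' => Inv iv.1 iv.2 -> Inv iv.1.+1 v'' /\ forall p,
      in_pid (T' ^+ (k + iv.1 - N) * w' ^+ (r - N)) (peval f' v'' p - peval f' iv.2 p))).
  move=> [i v'] /=; have [/step[v'' H] | nH] := classic (Inv i v'); first by exists v''.
  by exists v'.
pose V i := nat_rect (fun=> 'I_n -> A') (fun i => phi (v i)) (fun i v' => next (i, v')) i.
have InvV i : Inv i (V i) by elim: i => [|i /(Hnext (i, _))[]].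
have [lift liftK] := fun_choice _ _ _ pres.
exists (fun a i => peval f' (V i) (lift (a i))); split; last first.
  by move=> a i; rewrite -{2}(liftK (a i)); case: (InvV i).
have toT i a : (i <= k + i)%N -> in_pid (T' ^+ (k + i) * w' ^+ r) a -> in_pid (T' ^+ i) a.
  move=> le_i /pid_trans; apply; apply: (pid_trans _ (T' ^+ i * w' ^+ r)).
    exact: pid_exp_mul.
  by exists (w' ^+ r); rewrite mulrC.
apply: (compl_iso_limit _ _ _ f f' t n v V _ _ _ _ lift liftK) => [i j Jj | i p | i p H | i x].
- by have [vJ _] := InvV i; apply: toT (vJ j Jj); apply: leq_addl.
- have [_ H] := Hnext (i, V i) (InvV i); apply: pid_trans (H p) _.
  apply: (pid_trans _ (T' ^+ i * w' ^+ (r - N))); last by exists (w' ^+ (r - N)); rewrite mulrC.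
  by apply: pid_exp_mul => //=; lia.
- have close := Inv_close i _ (InvV i); have [vJ _] := InvV i.
  by apply: (psi_reflect_T _ _ _ f f' t w' (k + i) r n v (V i) nzT' pres vJ
    (close_reflect_T _ close)) => //; apply: leq_addl.
- have close := Inv_close i _ (InvV i).
  have [om [y [pi_om psi_om]]] := close_w _ close r1.
  have [p Hp] := psi_surj _ _ f' t w' n (V i) (close_surj _ close r1) om y psi_om i x.
  exists p; apply: pid_trans Hp _; exists (w' ^+ i); rewrite exprMn; ring.
Qed.
End Approximation.
End QuotIso.


Theorem mainTheorem12 (B : comNzRingType) (A : comPzRingType)
  (f : {rmorphism B -> A}) (t : B) (w : A) :
  noetherian B -> noetherian A -> flat f -> finite_type f ->
  nzd t -> nzd w ->
  (forall (r : nat) (a : A), in_pid (w ^+ r) (f t * a) -> in_pid (w ^+ r) a) ->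
  T1_supported_in f (f t * w) ->
  exists N M : nat, (0 < N)%N /\ (0 < M)%N /\
    forall (A' : comPzRingType) (f' : {rmorphism B -> A'}) (w' : A')
           (k r : nat) (phi : A -> A'),
      noetherian A' -> flat f' ->
      (4 * N < k)%N -> (4 * M < r)%N ->
      quot_iso f f' t w w' k r phi ->
      exists Phi : (nat -> A) -> (nat -> A'),
        compl_iso f f' t Phi /\
        restr_agree f f' t w' (k - 2 * N) (r - 2 * M) phi Phi.
Proof.
move=> noeB noeA flf _ nzt nzw reg [n [v [pres T1g]]].
have idJ : is_ideal (fun p => peval f v p = 0).
  split; first exact: rmorph0.
  - by move=> p q Hp Hq; rewrite rmorphD /= Hp Hq addr0.
  - by move=> p q Hq; rewrite rmorphM /= Hq mulr0.
have [s Hs] := noetherian_mpoly _ n noeB _ idJ.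
pose F (i : 'I_(size s)) := s`_i.
have FJ i : peval f v (F i) = 0 by apply/Hs; apply: mem_gen; apply: mem_nth.
have genJ j : peval f v j = 0 -> exists c, j = \sum_i c i * F i by move/Hs.
have [N lifting] := T1_lifting _ _ _ _ _ _ F pres FJ genJ (f t) w noeA T1g.
(* The successor secures positivity, and also 2N + 1 < r when [N] is 0. *)
exists N.+1, N.+1; do 2![split=> //] => A' f' w' k r phi noeA' flf' ltk ltr iso.
have nzT' := flat_nzd _ _ _ t flf' nzt.
have [e He] := krull_annihilator _ (f' t) noeA' nzT'.
have [||||Phi [isoPhi Hphi]] := completion_iso B A A' f f' t w w' k r phi nzT' nzw reg iso
   _ _ n v pres (size s) F N e genJ FJ (fun K => lifting K r) He.
- lia.
- lia.
- lia.
- lia.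
(* The difference lies in the product ideal itself, hence in the intersection, so the t-adic error
   term can be 0. *)
exists Phi; split=> // a _ i; exists 0, (Phi a i - phi (a i)); rewrite add0r; split=> //.
split; first exact: pid0.
split; apply: pid_trans (Hphi a i) _.
  by apply: (pid_trans _ (f' t ^+ (k - N))); [exists (w' ^+ (r - N)); rewrite mulrC | apply: pid_exp; lia].
by apply: (pid_trans _ (w' ^+ (r - N))); [exists (f' t ^+ (k - N)) | apply: pid_exp; lia].
Qed.
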